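(* Let $\mathcal{Q}:\mathbb{P}^2(\mathbb{K})\dashrightarrow X\subset\mathbb{P}^3(\mathbb{K})$ and $\mathcal{S}=(s_1:s_2:s_3):\mathbb{P}^2(\mathbb{K})\dashrightarrow\mathbb{P}^2(\mathbb{K})$ be rational maps, with $s_3\neq 0$, such that $\mathcal{Q}\circ\mathcal{S}=\mathcal{P}$. The following statements are equivalent: (1) $(\mathcal{Q},\mathcal{S})$ solves the birational reparametrization problem for $\mathcal{P}$. (2) $\mathscr{F}_g(\mathcal{P})=\mathscr{F}_g(\mathcal{S})$. Furthermore, if either of these two equivalent conditions holds, then: (a) For each $j\in\{1,2,3\}$, $$\Phi_j(t_1,t_2):=\left(\frac{s_1(t_1,t_2,1)}{s_3(t_1,t_2,1)},\ \frac{s_2(t_1,t_2,1)}{s_3(t_1,t_2,1)},\ \frac{p_j(t_1,t_2,1)}{p_4(t_1,t_2,1)}\right)$$ parametrizes an affine surface defined by an irreducible polynomial of the form $H_j(x,y,z)=A_{j,1}(x,y)-A_{j,0}(x,y)\,z$ with $A_{j,0}$ not zero. (b) $\mathcal{Q}(t_1,t_2,t_3)$ is the homogenization, with $t_3$ as homogenization variable, of $$\mathcal{T}:=\left(\frac{A_{1,1}(t_1,t_2)}{A_{1,0}(t_1,t_2)},\ \frac{A_{2,1}(t_1,t_2)}{A_{2,0}(t_1,t_2)},\ \frac{A_{3,1}(t_1,t_2)}{A_{3,0}(t_1,t_2)}\right).$$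
   Context: $\mathbb{K}$ is an algebraically closed field of characteristic zero. $X\subset\mathbb{P}^3(\mathbb{K})$ is a rational projective surface, and $\mathcal{P}(\overline t)=(p_1(\overline t):p_2(\overline t):p_3(\overline t):p_4(\overline t))$, $\overline t=(t_1,t_2,t_3)$, is a fixed non-birational projective rational parametrization of $X$: the $p_i\in\mathbb{K}[t_1,t_2,t_3]$ are homogeneous, the non-zero ones of the same degree, $\gcd(p_1,\ldots,p_4)=1$, $p_4\neq0$, and $\mathcal{P}:\mathbb{P}^2(\mathbb{K})\dashrightarrow X$ is dominant (hence generically finite) but not birational. A rational map $\mathcal{S}=(s_1:s_2:s_3)$ is given by polynomials $s_i\in\mathbb{K}[t_1,t_2,t_3]$ whose non-zero members are homogeneous of the same degree. Generic fiber: for a rational map $\mathcal{M}:\mathbb{P}^2(\mathbb{K})\dashrightarrow\mathbb{P}^k(\mathbb{K})$, let $\overline h=(h_1,h_2,h_3)$ be a tuple of independent parameters and $\overline{\mathbb{K}(\overline h)}$ the algebraic closure of $\mathbb{K}(\overline h)$; then $\mathscr{F}_g(\mathcal{M}):=\{\overline\alpha\in\mathbb{P}^2(\overline{\mathbb{K}(\overline h)})\mid\mathcal{M}(\overline\alpha)=\mathcal{M}(\overline h)\}$. $(\mathcal{Q},\mathcal{S})$ solves the birational reparametrization problem for $\mathcal{P}$ if $\mathcal{Q}$ is a birational parametrization of $X$ (i.e. a birational map $\mathbb{P}^2(\mathbb{K})\dashrightarrow X$), $\mathcal{S}:\mathbb{P}^2(\mathbb{K})\dashrightarrow\mathbb{P}^2(\mathbb{K})$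 is a rational map, and $\mathcal{P}(\overline t)=\mathcal{Q}(\mathcal{S}(\overline t))$. *)

(* Defs.v *)
From HB Require Import structures.
From mathcomp Require Import all_boot all_order all_algebra.
From mathcomp Require Import mpoly.

Set Implicit Arguments.
Unset Strict Implicit.
Unset Printing Implicit Defensive.

Import GRing.Theory.
Local Open Scope ring_scope.

Local Notation "x %:F" := (tofrac x) : ring_scope.

(* A point of P^(n-1) is given by a nonzero vector 'I_n -> K of homogeneous
   coordinates, and a subset of P^(n-1) by a predicate on such vectors.  A
   rational map P^(n-1) - -> P^(m-1) is given by a tuple 'I_m -> {mpoly K[n]}
   satisfying [rational_map]; common factors are allowed. *)

Definition nonzero (R : nmodType) (n : nat) (u : 'I_n -> R) : Prop :=
  exists i, u i != 0.

(* Over a field: u and v are homogeneous coordinates of the same point.  Over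
   {mpoly K[n]}: u and v are the same rational map. *)
Definition proj_eq (R : idomainType) (n : nat) (u v : 'I_n -> R) : Prop :=
  [/\ nonzero u, nonzero v & forall i j, u i * v j = u j * v i].

Definition homogeneous (K : fieldType) (n : nat) (p : {mpoly K[n]}) : Prop :=
  exists d : nat, p \is d.-homog.

Definition irreducible_mpoly (K : fieldType) (n : nat) (p : {mpoly K[n]}) :
    Prop :=
  [/\ p != 0, p \isn't a GRing.unit &
      forall a b : {mpoly K[n]}, p = a * b ->
        a \is a GRing.unit \/ b \is a GRing.unit].

Definition coprime_family (K : fieldType) (n m : nat)
    (F : 'I_m -> {mpoly K[n]}) : Prop :=
  forall g : {mpoly K[n]},
    (forall i, exists q, F i = q * g) -> g \is a GRing.unit.

(* The zero polynomial is d-homogeneous for every d. *)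
Definition rational_map (K : fieldType) (n m : nat)
    (F : 'I_m -> {mpoly K[n]}) : Prop :=
  (exists d : nat, forall i, F i \is d.-homog) /\ nonzero F.

Definition evalv (K : fieldType) (n m : nat) (F : 'I_m -> {mpoly K[n]})
    (x : 'I_n -> K) : 'I_m -> K :=
  fun i => (F i).@[x].

(* G o F, as a tuple of polynomials *)
Definition rcomp (K : fieldType) (n m k : nat) (G : 'I_k -> {mpoly K[m]})
    (F : 'I_m -> {mpoly K[n]}) : 'I_k -> {mpoly K[n]} :=
  fun i => G i \mPo [tuple F j | j < m].

(* A surface of P^3 is an irreducible hypersurface. *)
Definition projective_surface (K : fieldType) (X : ('I_4 -> K) -> Prop) :
    Prop :=
  exists F : {mpoly K[4]},
    [/\ homogeneous F, irreducible_mpoly F &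
        forall x, X x <-> nonzero x /\ F.@[x] = 0].

Definition maps_into (K : fieldType) (n m : nat) (F : 'I_m -> {mpoly K[n]})
    (X : ('I_m -> K) -> Prop) : Prop :=
  forall t, nonzero t -> nonzero (evalv F t) -> X (evalv F t).

(* The image lies in X and every form vanishing on the image vanishes on X. *)
Definition dominant (K : fieldType) (n m : nat) (F : 'I_m -> {mpoly K[n]})
    (X : ('I_m -> K) -> Prop) : Prop :=
  maps_into F X /\
  forall G : {mpoly K[m]}, homogeneous G ->
    (forall t, nonzero t -> nonzero (evalv F t) -> G.@[evalv F t] = 0) ->
    forall x, X x -> G.@[x] = 0.

(* For X irreducible, a rational map X - -> P^(n-1) is given by a single tuple
   R of forms not all vanishing on X.  R is required to be an inverse of F:
   R o F is the identity, and F o R is defined somewhere on X and is the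
   identity of X wherever it is defined. *)
Definition birational (K : fieldType) (n m : nat) (F : 'I_m -> {mpoly K[n]})
    (X : ('I_m -> K) -> Prop) : Prop :=
  [/\ rational_map F, dominant F X &
      exists R : 'I_n -> {mpoly K[m]},
        [/\ rational_map R,
            proj_eq (rcomp R F) (fun i => 'X_i),
            exists x, [/\ X x, nonzero (evalv R x) &
                          nonzero (evalv F (evalv R x))] &
            forall x, X x -> nonzero (evalv R x) ->
              nonzero (evalv F (evalv R x)) ->
              proj_eq (evalv F (evalv R x)) x]].

Definition rational_surface (K : fieldType) (X : ('I_4 -> K) -> Prop) : Prop :=
  projective_surface X /\ exists B : 'I_4 -> {mpoly K[3]}, birational B X.

Definition solves_reparametrization (K : fieldType) (X : ('I_4 -> K) -> Prop)
    (P Q : 'I_4 -> {mpoly K[3]}) (S : 'I_3 -> {mpoly K[3]}) : Prop :=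
  [/\ birational Q X, rational_map S & proj_eq P (rcomp Q S)].

(* iota exhibits L as an algebraic closure of F. *)
Definition is_algebraic_closure (F : fieldType) (L : closedFieldType)
    (iota : {rmorphism F -> L}) : Prop :=
  forall x : L, algebraicOver iota x.

Definition evalL (K L : fieldType)
    (iota : {rmorphism {fraction {mpoly K[3]}} -> L}) (m : nat)
    (M : 'I_m -> {mpoly K[3]}) (a : 'I_3 -> L) : 'I_m -> L :=
  fun i => mmap (fun c : K => iota (c%:MP%:F)) a (M i).

(* The parameters h are the images in L of the variables of K(h_1,h_2,h_3);
   [proj_eq] includes that M is defined at a. *)
Definition generic_fiber (K L : fieldType)
    (iota : {rmorphism {fraction {mpoly K[3]}} -> L}) (m : nat)
    (M : 'I_m -> {mpoly K[3]}) (a : 'I_3 -> L) : Prop :=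
  nonzero a /\
  proj_eq (evalL iota M a) (evalL iota M (fun i => iota ('X_i)%:F)).

(* p(t_1,t_2,1) *)
Definition dehom (K : fieldType) (p : {mpoly K[3]}) : {mpoly K[2]} :=
  p \mPo [tuple 'X_0; 'X_1; 1].

Definition Phi (K : fieldType) (P : 'I_4 -> {mpoly K[3]})
    (S : 'I_3 -> {mpoly K[3]}) (j : 'I_3) : 'I_3 -> {fraction {mpoly K[2]}} :=
  tnth [tuple (dehom (S 0))%:F / (dehom (S ord_max))%:F;
              (dehom (S 1))%:F / (dehom (S ord_max))%:F;
              (dehom (P (widen_ord (leqnSn 3) j)))%:F
                / (dehom (P ord_max))%:F].

(* Y is the Zariski closure of the image of the rational map f : A^n - -> A^m.
   As K is infinite, G vanishes on the image iff G(f) = 0 in K(t_1,..,t_n). *)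
Definition parametrizes (K : fieldType) (n m : nat)
    (f : 'I_m -> {fraction {mpoly K[n]}}) (Y : ('I_m -> K) -> Prop) : Prop :=
  forall x, Y x <->
    forall G : {mpoly K[m]},
      mmap (fun c : K => c%:MP%:F) f G = 0 -> G.@[x] = 0.

(* A1(x,y) - A0(x,y) z *)
Definition linz (K : fieldType) (A1 A0 : {mpoly K[2]}) : {mpoly K[3]} :=
  mwiden A1 - mwiden A0 * 'X_ord_max.

Definition Phi_surface (K : fieldType) (P : 'I_4 -> {mpoly K[3]})
    (S : 'I_3 -> {mpoly K[3]}) (j : 'I_3) (A1 A0 : {mpoly K[2]}) : Prop :=
  [/\ A0 != 0, irreducible_mpoly (linz A1 A0) &
      parametrizes (Phi P S j) (fun x => (linz A1 A0).@[x] = 0)].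

(* A(t_1/t_3, t_2/t_3) *)
Definition subst_t3 (K : fieldType) (A : {mpoly K[2]}) :
    {fraction {mpoly K[3]}} :=
  mmap (fun c : K => c%:MP%:F)
    (fun i : 'I_2 => ('X_(widen_ord (leqnSn 2) i))%:F / ('X_ord_max)%:F) A.

(* Q(t) = (T_1(t_1/t_3,t_2/t_3) : T_2(..) : T_3(..) : 1) where T_j = N j / D j *)
Definition is_homogenization (K : fieldType) (Q : 'I_4 -> {mpoly K[3]})
    (N D : 'I_3 -> {mpoly K[2]}) : Prop :=
  proj_eq (fun i => (Q i)%:F)
    (fun i : 'I_4 => if unlift ord_max i is Some j
                     then subst_t3 (N j) / subst_t3 (D j) else 1).

(* Main.v *)
Require Import Defs.
From HB Require Import structures.
From mathcomp Require Import all_boot all_order all_algebra all_field.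
From mathcomp Require Import mpoly zify ring.
From Stdlib Require Import Classical ClassicalEpsilon.

(** Write F ~ G when two tuples of forms define the same rational map, so that
    P ~ Q o S.  Dominance enters through algebraic independence.  Since X is
    rational, an inverse R of a birational parametrization of X turns every
    dominant P into three algebraically independent forms R o P
    ([dominant_independent]).  Comparing dimensions of spaces of forms replaces
    transcendence degrees: three ternary forms satisfy a relation modulo any
    given form g ([form_relation_mod]), and four ternary forms of the same
    degree are always dependent ([form_relation]).  It follows that the
    components of S are independent ([source_independent]), and that no point
    of the generic fiber of P or of S lies on a plane curve defined over K
    ([fiber_avoids_curves]), so that identities between rational maps may be
    evaluated there.

    If Q is birational with inverse R, then P ~ Q o S and S ~ R o P, hence at
    such points P(a) ~ P(h) and S(a) ~ S(h) imply each other.  Conversely, let E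
    be the field K(P_1(h),..,P_4(h)).  The h_i are algebraic over E, again by
    [form_relation], so E(h) has a primitive element theta and h = g(theta) with
    polynomials g over E.  Every conjugate theta' of theta gives a point
    a = g(theta') with P(a) = P(h), so S(a) ~ S(h): the ratios of the S_i(h),
    which are rational functions of theta, take the same value at all
    conjugates.  As theta is separable they lie in E ([conjugates_descend]).
    Clearing denominators and keeping one homogeneous component gives forms R
    with R o P ~ S ([fiber_inclusion_descends]), and R is inverse to Q because
    S and P are dominant ([inverse_birational]).

    For (a) and (b), sigma = (s_1/s_3, s_2/s_3) is a generic point of the affine
    plane and p_j/p_4 = Q_j(sigma,1)/Q_4(sigma,1).  Writing Q_j(x,y,1)/Q_4(x,y,1)
    as a fraction A_1/A_0 in lowest terms makes A_1 - A_0 z irreducible; as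
    polynomial rings are factorial ([factorial_mpoly]) it is prime, and
    pseudo-division in z shows that it generates all relations between the
    coordinates of Phi_j ([vanishing_ideal_linz]).  Conversely the equation of
    the surface parametrized by Phi_j vanishes at Phi_j, which forces
    A_1/A_0 = Q_j(x,y,1)/Q_4(x,y,1). *)

Set Implicit Arguments.
Unset Strict Implicit.
Unset Printing Implicit Defensive.

Import GRing.Theory.
Local Open Scope ring_scope.

Local Notation "G .[o F ]" := (G \mPo [tuple F j | j < _])
  (at level 2, format "G .[o F ]").
Local Notation "x %:F" := (tofrac x) : ring_scope.

(** * Substitution and homogeneous polynomials *)

Section Substitution.

Variables (A B C : comNzRingType).

Lemma mmapXU n (f : {rmorphism A -> B}) (h : 'I_n -> B) i :
  mmap f h 'X_i = h i.
Proof. by rewrite mmapX mmap1U. Qed.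

Lemma eq_mmap n (f f' : A -> B) (h h' : 'I_n -> B) p :
  f =1 f' -> h =1 h' -> mmap f h p = mmap f' h' p.
Proof.
move=> ff hh; apply: eq_bigr => m _; rewrite ff; congr (_ * _).
by apply: eq_bigr => i _; rewrite hh.
Qed.

Lemma rmorph_mmap n (psi : {rmorphism B -> C}) (f : A -> B)
    (h : 'I_n -> B) p :
  psi (mmap f h p) = mmap (psi \o f) (psi \o h) p.
Proof.
rewrite rmorph_sum; apply: eq_bigr => m _; rewrite rmorphM; congr (_ * _).
by rewrite rmorph_prod; apply: eq_bigr => i _; rewrite rmorphXn.
Qed.

(** The universal property of polynomial rings: two morphisms are compared by
    their values on constants and on variables. *)
Lemma rmorph_mpoly n (psi : {rmorphism {mpoly A[n]} -> B}) p :
  psi p = mmap (psi \o @mpolyC n A) (fun i => psi 'X_i) p.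
Proof.
rewrite {1}[p]mpolyE rmorph_sum; apply: eq_bigr => m _.
rewrite -mul_mpolyC rmorphM; congr (_ * _).
by rewrite mpolyXE_id rmorph_prod; apply: eq_bigr => i _; rewrite rmorphXn.
Qed.

End Substitution.

Section Homogeneous.

Variables (A B : comNzRingType).

Lemma mmap_subst n m (f : {rmorphism A -> B}) (h : 'I_n -> B)
    (F : 'I_m -> {mpoly A[n]}) G :
  mmap f h G.[o F] = mmap f (fun i => mmap f h (F i)) G.
Proof.
rewrite /comp_mpoly (rmorph_mmap (mmap f h)); apply: eq_mmap => [c|i] /=.
  by rewrite mmapC.
by rewrite tnth_mktuple.
Qed.

Lemma substE n m (F : 'I_m -> {mpoly A[n]}) G :
  G.[o F] = mmap (@mpolyC n A) F G.
Proof. by apply: eq_mmap => // i; rewrite tnth_mktuple. Qed.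

Lemma mmap_homogZ n d (f : {rmorphism A -> B}) (c : B) (h : 'I_n -> B) p :
  p \is d.-homog -> mmap f (fun i => c * h i) p = c ^+ d * mmap f h p.
Proof.
move/dhomogP => pd; rewrite /mmap mulr_sumr !big_seq; apply: eq_bigr => m mp.
rewrite mulrCA; congr (_ * _).
have /= <- := pd _ mp; rewrite /mmap1 mdegE -prodrXr -big_split /=.
by apply: eq_bigr => i _; rewrite exprMn.
Qed.

Lemma subst_homog n m d e (F : 'I_m -> {mpoly A[n]}) G :
  (forall i, F i \is d.-homog) -> G \is e.-homog ->
  G.[o F] \is (d * e).-homog.
Proof.
move=> Fd /dhomogP Ge; rewrite substE /mmap big_seq rpred_sum // => mu mup.
rewrite mul_mpolyC; apply: rpredZ.
have /= <- := Ge _ mup; rewrite /mmap1 mdegE big_distrr /=.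
elim/big_ind2: _ => [|? ? ? ? ? ?|i _]; first exact: dhomog1.
  exact: dhomogM.
exact: dhomogMn.
Qed.

Lemma pihomog_subst n m d e (F : 'I_m -> {mpoly A[n]}) G :
  (0 < d)%N -> (forall i, F i \is d.-homog) ->
  (pihomog mdeg e G).[o F] = pihomog mdeg (d * e) G.[o F].
Proof.
move=> d0 Fd; rewrite {2}[G]mpolyE pihomogE !(rmorph_sum (comp_mpoly _)) linear_sum /=.
rewrite big_mkcond /=; apply: eq_bigr => mu _.
rewrite comp_mpolyZ linearZ /=.
have hX : 'X_[mu].[o F] \is (d * mdeg mu).-homog.
  by apply: subst_homog => //; rewrite dhomogX.
case: eqP => [<-|ne]; first by rewrite pihomog_dE.
rewrite (pihomog_ne0 _ hX) ?scaler0 //.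
by rewrite eqn_pmul2l //; apply/eqP.
Qed.

Lemma pihomog_eq0 n (p : {mpoly A[n]}) :
  (forall d, pihomog mdeg d p = 0) -> p = 0.
Proof.
move=> H; rewrite (pihomog_partitionE (leqnn (msize p))).
by rewrite big1.
Qed.

End Homogeneous.

(** Evaluation in two steps: [muni] is the identification of A[x_1,..,x_(n+1)]
    with A[x_1,..,x_n][x_(n+1)]. *)
Lemma horner_muni (A B : comNzRingType) n (f : {rmorphism A -> B})
    (h : 'I_n.+1 -> B) p :
  mmap f h p =
  (map_poly (mmap f (fun i : 'I_n => h (widen_ord (leqnSn n) i))) (muni p)).[h ord_max].
Proof.
pose phi : {rmorphism {mpoly A[n.+1]} -> B} := horner_eval (h ord_max) \o
  (map_poly (mmap f (fun i : 'I_n => h (widen_ord (leqnSn n) i))) \o @muni n A).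
transitivity (phi p); last by [].
rewrite (rmorph_mpoly phi); apply: eq_mmap => [c|i] /=.
  by rewrite muniC map_polyC /= /horner_eval hornerC mmapC.
rewrite /muni mmapXU /=; case: splitP => j /= ij.
  rewrite map_polyC /= /horner_eval hornerC mmapXU; congr h.
  by apply/val_inj.
rewrite map_polyX /horner_eval hornerX; congr h; apply/val_inj => /=.
by rewrite ij ord1 addn0.
Qed.

Lemma muni_widen (A : comNzRingType) n (p : {mpoly A[n]}) :
  muni (mwiden p) = p%:P.
Proof.
transitivity ((@muni n A \o @mwiden n A) p); first by [].
rewrite rmorph_mpoly [RHS](rmorph_mpoly (@polyC {mpoly A[n]})).
apply: eq_mmap => [c|i] /=; first by rewrite mwidenC muniC.
rewrite /mwiden mmapXU /muni mmapXU /=; case: splitP => j /= ij.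
  by congr ('X__)%:P; apply/val_inj.
by have := ltn_ord i; rewrite ij ord1 addn0 ltnn.
Qed.

Lemma muni_max (A : comNzRingType) n : muni ('X_ord_max : {mpoly A[n.+1]}) = 'X.
Proof.
rewrite /muni mmapXU /=; case: splitP => // j /= ij.
by have := ltn_ord j; rewrite -ij ltnn.
Qed.

Lemma mmultiK (A : comNzRingType) n : cancel (@mmulti n A) (@muni n A).
Proof.
move=> p; rewrite /mmulti raddf_sum /=.
rewrite -[RHS]coefK poly_def; apply: eq_bigr => i _.
by rewrite rmorphM rmorphXn /= muni_widen muni_max mul_polyC.
Qed.

Lemma muni_inj (A : comNzRingType) n : injective (@muni n A).
Proof.
have H : cancel (@muni n A) (fun q => (map_poly (@mwiden n A) q).['X_ord_max]).
  move=> p.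
  transitivity (mmap (@mpolyC n.+1 A) (fun i => 'X_i) p).
    by rewrite (horner_muni (@mpolyC n.+1 A)).
  by rewrite -substE comp_mpoly_id.
exact: can_inj H.
Qed.

Lemma X_neq0 (K : fieldType) n (i : 'I_n) : 'X_i != 0 :> {mpoly K[n]}.
Proof. by rewrite -msize_poly_eq0 msizeX. Qed.

Lemma widen_lift n (i : 'I_n) : widen_ord (leqnSn n) i = lift ord_max i.
Proof. by apply/val_inj; rewrite /= /bump leqNgt ltn_ord. Qed.

(** The point (u_0 : .. : u_(n-1) : w); the last coordinate plays the role of
    the homogenizing variable, as in [muni]. *)
Definition extend (A : Type) n (u : 'I_n -> A) (w : A) (i : 'I_n.+1) : A :=
  if unlift ord_max i is Some j then u j else w.

Lemma extend_max (A : Type) n (u : 'I_n -> A) (w : A) : extend u w ord_max = w.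
Proof. by rewrite /extend unlift_none. Qed.

Lemma extend_widen (A : Type) n (u : 'I_n -> A) (w : A) i :
  extend u w (widen_ord (leqnSn n) i) = u i.
Proof. by rewrite /extend widen_lift liftK. Qed.

Lemma eq_extend (A : Type) n (h : 'I_n.+1 -> A) :
  extend (fun i => h (widen_ord (leqnSn n) i)) (h ord_max) =1 h.
Proof.
by move=> i; rewrite /extend; case: unliftP => [j|] -> //; rewrite widen_lift.
Qed.

(** * Proportional vectors and values of forms *)

Section ProjectivePoints.

Variables (R : idomainType) (n : nat).
Implicit Types u v w : 'I_n -> R.

Lemma proj_eqP u v :
  proj_eq u v -> exists c d, [/\ c != 0, d != 0 & forall i, c * u i = d * v i].
Proof.
case=> -[i ui] [j vj] uv; exists (v i), (u i); split=> //; last first.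
  by move=> k; rewrite mulrC -uv.
apply: contraNneq vj => vi; have := uv i j; rewrite vi mulr0 => /eqP.
by rewrite mulf_eq0 (negPf ui).
Qed.

Lemma proj_eqI u v c d : nonzero u -> c != 0 -> d != 0 ->
  (forall i, c * u i = d * v i) -> proj_eq u v.
Proof.
move=> [i ui] c0 d0 uv; split; first by exists i.
  exists i; apply: contra_neq ui => vi; apply: (mulfI c0).
  by rewrite uv vi !mulr0.
move=> k j; apply: (mulfI (mulf_neq0 c0 d0)).
have -> : c * d * (u k * v j) = (c * u k) * (d * v j) by ring.
by rewrite -uv uv; ring.
Qed.

Lemma eq_proj_eq u u' v v' : u =1 u' -> v =1 v' -> proj_eq u v -> proj_eq u' v'.
Proof.
move=> uu vv [[i ui] [j vj] uv].
by split; [exists i | exists j | move=> k l]; rewrite -?uu -?vv.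
Qed.

Lemma proj_eq_sym u v : proj_eq u v -> proj_eq v u.
Proof.
case=> u0 v0 uv; split=> // i j; by rewrite mulrC -uv mulrC.
Qed.

Lemma proj_eq_trans v u w : proj_eq u v -> proj_eq v w -> proj_eq u w.
Proof.
move=> uv0; have [u0 _ _] := uv0; move/proj_eqP: uv0 => [c [d [c0 d0 uv]]].
move=> /proj_eqP[c' [d' [c0' d0' vw]]].
apply: (@proj_eqI _ _ (c' * c) (d * d')); rewrite ?mulf_neq0 // => i.
by rewrite -mulrA uv mulrCA vw mulrA.
Qed.

End ProjectivePoints.

Section FormsAtPoints.

Variables (K : fieldType) (A : idomainType) (f : {rmorphism K -> A}).

(** Forms of degree r multiply by c^r when their arguments are multiplied by c. *)
Lemma proj_eq_forms m k r (G : 'I_k -> {mpoly K[m]}) (u v : 'I_m -> A) :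
  (forall i, G i \is r.-homog) -> proj_eq u v ->
  nonzero (fun i => mmap f u (G i)) ->
  proj_eq (fun i => mmap f u (G i)) (fun i => mmap f v (G i)).
Proof.
move=> Gr /proj_eqP[c [d [c0 d0 uv]]] G0.
apply: (@proj_eqI _ _ _ _ (c ^+ r) (d ^+ r)); rewrite ?expf_neq0 // => i.
by rewrite -!(mmap_homogZ f _ _ (Gr i)); apply: eq_mmap.
Qed.

Lemma form_eq0 m r (G : {mpoly K[m]}) (u v : 'I_m -> A) :
  G \is r.-homog -> proj_eq u v -> mmap f u G = 0 -> mmap f v G = 0.
Proof.
move=> Gr /proj_eqP[c [d [c0 d0 uv]]] G0.
apply: (mulfI (expf_neq0 r d0)); rewrite mulr0 -(mmap_homogZ f _ _ Gr).
rewrite (eq_mmap (f' := f) (h' := fun i => c * u i)) //.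
by rewrite (mmap_homogZ _ _ _ Gr) G0 mulr0.
Qed.

Lemma proj_eq_at n m (F F' : 'I_m -> {mpoly K[n]}) (a : 'I_n -> A) :
  proj_eq F F' -> nonzero (fun i => mmap f a (F i)) ->
  nonzero (fun i => mmap f a (F' i)) ->
  proj_eq (fun i => mmap f a (F i)) (fun i => mmap f a (F' i)).
Proof.
by case=> _ _ FF F0 F0'; split=> // i j; rewrite -!rmorphM FF.
Qed.

End FormsAtPoints.

(** * Polynomials are determined by their values *)

(** Nonzero polynomials are nonzero functions: the property of infinite fields
    that translates statements about points of X into polynomial identities. *)
Definition points_detect (K : fieldType) : Prop :=
  forall n (p : {mpoly K[n]}), p != 0 -> exists t : 'I_n -> K, p.@[t] != 0.

Lemma closed_points_detect (K : closedFieldType) : points_detect K.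
Proof.
elim=> [|n IH] p p0.
  exists (fun => 0); move: p0; rewrite [X in meval _ X]nvar0_mpolyC mevalC.
  by apply: contraNneq => p00; rewrite [p]nvar0_mpolyC p00 mpolyC0.
have q0 : muni p != 0 by rewrite -(muni0 n K) (inj_eq (@muni_inj _ _)).
have /IH[t tq] : lead_coef (muni p) != 0 by rewrite lead_coef_eq0.
have /closed_nonrootP[x xq] : map_poly (meval t) (muni p) != 0.
  apply: contraNneq tq => /(congr1 (fun q : {poly K} => q`_(size (muni p)).-1)).
  by rewrite coef_map coef0 => /eqP.
exists (extend t x); rewrite [X in X != 0](horner_muni _ _ p) extend_max.
suff -> : map_poly (mmap idfun (fun i : 'I_n =>
    extend t x (widen_ord (leqnSn n) i))) (muni p)
  = map_poly (meval t) (muni p) by [].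
by apply: eq_map_poly => q; apply: eq_mmap => // i; apply: extend_widen.
Qed.

(** * Algebraically independent forms *)

Definition alg_independent (K : fieldType) (n m : nat)
    (F : 'I_m -> {mpoly K[n]}) : Prop :=
  forall G : {mpoly K[m]}, G.[o F] = 0 -> G = 0.

(** Vanishing on the image of a rational map is a condition on forms, so
    independence is available for homogeneous relations first.  The degree is
    positive because two constants satisfy a linear relation; then
    distinct homogeneous components of a relation have distinct degrees and
    vanish separately. *)
Lemma alg_independent_forms (K : fieldType) (n m d : nat)
    (F : 'I_m.+2 -> {mpoly K[n]}) :
  (forall i, F i \is d.-homog) ->
  (forall e (G : {mpoly K[m.+2]}), G \is e.-homog -> G.[o F] = 0 -> G = 0) ->
  (0 < d)%N /\ alg_independent F.
Proof.
move=> Fd H; have d0 : (0 < d)%N.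
  rewrite lt0n; apply/eqP => d0; rewrite d0 in Fd.
  have FC i : F i = ((F i)@_0%MM)%:MP.
    apply/mpolyP => mu; rewrite mcoeffC; case: eqP => [<-|/eqP ne].
      by rewrite mulr1.
    rewrite mulr0; apply: (dhomog_nemf_coeff (Fd i)) => /=.
    by rewrite mdeg_eq0.
  pose c i := (F i)@_0%MM.
  have cX (i j : 'I_m.+2) : i != j -> c i = 0 /\ c j = 0.
    move=> ij.
    have /H : c j *: 'X_i - c i *: 'X_j \is 1.-homog.
      by rewrite rpredB // rpredZ // dhomogX /= mdeg1.
    rewrite rmorphB /= !comp_mpolyZ /=.
    have sX k : ('X_k).[o F] = (c k)%:MP by rewrite substE mmapXU /c -FC.
    rewrite !sX -!mul_mpolyC mulrC subrr => /(_ erefl) G0.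
    have := congr1 (mcoeff U_(i)) G0; have := congr1 (mcoeff U_(j)) G0.
    rewrite !mcoeffB !mcoeffCM !mcoeffXU !eqxx [j == i]eq_sym (negPf ij).
    rewrite !mcoeff0 !mulr0 !mulr1 subr0 sub0r => /eqP; rewrite oppr_eq0.
    by move=> /eqP.
  have [c0 _] := cX ord0 (lift ord0 ord0) isT.
  have : 'X_ord0 = 0 :> {mpoly K[m.+2]}.
    apply: (H 1%N); first by rewrite dhomogX /= mdeg1.
    by rewrite substE mmapXU FC -/(c ord0) c0 mpolyC0.
  by apply/eqP/X_neq0.
split=> // G G0; apply: pihomog_eq0 => e; apply: (H e (pihomog mdeg e G)).
  exact: pihomogP.
by rewrite (pihomog_subst _ _ d0 Fd) G0 pihomog0.
Qed.

Lemma alg_independent_neq0 (K : fieldType) (n m : nat)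
    (F : 'I_m -> {mpoly K[n]}) i :
  alg_independent F -> F i != 0.
Proof.
move=> indF; apply/eqP => Fi; have : 'X_i = 0 :> {mpoly K[m]}.
  by apply: indF; rewrite substE mmapXU.
by apply/eqP/X_neq0.
Qed.

Lemma proj_eq_independent (K : fieldType) (n m d : nat)
    (F F' : 'I_m.+2 -> {mpoly K[n]}) :
  (forall i, F' i \is d.-homog) -> proj_eq F F' -> alg_independent F ->
  (0 < d)%N /\ alg_independent F'.
Proof.
move=> Fd /proj_eq_sym FF indF; apply: (alg_independent_forms Fd) => e G Ge.
rewrite substE => /(form_eq0 Ge FF) G0; apply: indF.
by rewrite substE.
Qed.

(** * Relations found by counting dimensions *)

Section Kernel.

Variables (K : fieldType) (U V : vectType K) (phi : U -> V).
Hypothesis phi_linear : linear phi.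

HB.instance Definition _ := GRing.isLinear.Build K U V _ phi phi_linear.

Lemma kernel_nontrivial :
  (dim V < dim U)%N -> exists2 u : U, u != 0 & phi u = 0.
Proof.
move=> dUV; have : lker (linfun phi) != 0%VS.
  rewrite -dimv_eq0 -lt0n.
  have := limg_ker_dim (linfun phi) fullv; rewrite capfv dimvf.
  have := dimvS (subvf (limg (linfun phi))); rewrite dimvf.
  lia.
rewrite -vpick0 => v0; exists (vpick (lker (linfun phi))) => //.
by have := memv_pick (lker (linfun phi)); rewrite memv_ker lfunE => /eqP.
Qed.

End Kernel.

Lemma dim_prod (K : fieldType) (U V : vectType K) :
  dim (U * V)%type = (dim U + dim V)%N.
Proof. by []. Qed.

Lemma dim_ternary_forms (K : fieldType) d :
  (2 * dim (dhomog 3 K d) = d.+1 * d.+2)%N.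
Proof.
rewrite [dim _](_ : _ = 'C(d + 2, d)) // -{2}[d](addnK 2) bin_sub ?leq_addl //.
by rewrite addn2 -(mul_bin_diag d.+2 1) /= bin1 mulnC.
Qed.

Lemma dim_quaternary_forms (K : fieldType) d :
  (6 * dim (dhomog 4 K d) = d.+1 * d.+2 * d.+3)%N.
Proof.
rewrite [dim _](_ : _ = 'C(d + 3, d)) // -{2}[d](addnK 3) bin_sub ?leq_addl //.
rewrite addn3 (_ : 6 = 2 * 3)%N // -mulnA -(mul_bin_diag d.+3 2) /=.
by rewrite mulnCA -(mul_bin_diag d.+2 1) /= bin1; lia.
Qed.

(** The forms of degree m in V span a space whose dimension is quadratic in m,
    but forms of degree N = D m modulo g only have a dimension linear in m.
    With m = 2 e D the map (G, q) |-> G(V) - q g has a nontrivial kernel. *)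
Lemma form_relation_mod (K : fieldType) D e (V : 'I_3 -> {mpoly K[3]}) g :
  (0 < D)%N -> (forall i, V i \is D.-homog) -> g \is e.-homog -> g != 0 ->
  exists m (G q : {mpoly K[3]}), [/\ G \is m.-homog, G != 0 & G.[o V] = q * g].
Proof.
move=> D0 Vd ge g0; pose m := (2 * e * D)%N; pose N := (D * m)%N.
have eN : (e <= N)%N by rewrite /N /m; nia.
have hom (u : dhomog 3 K m * dhomog 3 K (N - e)) :
    (val u.1).[o V] - val u.2 * g \is N.-homog.
  apply: rpredB; first by apply: subst_homog => //; exact: dhomog_is_dhomog.
  have := dhomogM (dhomog_is_dhomog u.2) ge; rewrite subnK //.
have lin : linear (fun u => DHomog (hom u)).
  move=> c u v; apply/val_inj => /=.
  rewrite comp_mpolyD comp_mpolyZ scalerBr.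
  by rewrite mulrDl scalerAl opprD addrACA.
have [|[G q] /= Gq0 /(congr1 val) /= /eqP] := kernel_nontrivial lin.
  have := dim_ternary_forms K m; have := dim_ternary_forms K N.
  have := dim_ternary_forms K (N - e).
  rewrite dim_prod.
  move: (dim _) (dim _) (dim _) => a b c.
  have [r Nr] : exists r, N = (r + e)%N by exists (N - e)%N; rewrite subnK.
  have : (2 * e * N = m * m)%N by rewrite /N /m; lia.
  have : (e <= m)%N by rewrite /m; nia.
  rewrite Nr addnK; clear; lia.
rewrite subr_eq0 => /eqP GV; exists m, (val G), (val q); split=> //.
  exact: dhomog_is_dhomog.
apply: contraNneq Gq0 => G0; apply/eqP; congr pair; apply/val_inj => //=.
move/esym/eqP: GV; rewrite G0 comp_mpoly0 mulf_eq0 (negPf g0) orbF.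
by move/eqP.
Qed.

(** The dimension of quaternary forms of degree m is cubic in m, that of ternary
    forms of degree D m is quadratic; m = 3 D^2 is large enough. *)
Lemma form_relation (K : fieldType) D (F : 'I_4 -> {mpoly K[3]}) :
  (0 < D)%N -> (forall i, F i \is D.-homog) ->
  exists2 G : {mpoly K[4]}, G != 0 & G.[o F] = 0.
Proof.
move=> D0 Fd; pose m := (3 * D * D)%N; pose N := (D * m)%N.
have hom (u : dhomog 4 K m) : (val u).[o F] \is N.-homog.
  by apply: subst_homog => //; exact: dhomog_is_dhomog.
have lin : linear (fun u => DHomog (hom u)).
  by move=> c u v; apply/val_inj => /=; rewrite comp_mpolyD comp_mpolyZ.
have [|G G0 /(congr1 val) /= GF] := kernel_nontrivial lin.
  have := dim_ternary_forms K N; have := dim_quaternary_forms K m.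
  move: (dim _) (dim _) => a b.
  have : (N.+1 <= D * m.+1)%N by rewrite /N; nia.
  have : (N.+2 <= D * m.+2)%N by rewrite /N; nia.
  move=> h1 h2 ha hb; have := leq_mul h2 h1.
  have : (3 * (D * m.+1 * (D * m.+2)) = m * (m.+1 * m.+2))%N by rewrite /m; lia.
  clear -ha hb; lia.
by exists (val G).
Qed.

(** * Generic points and points on no curve *)

Lemma substA (A : fieldType) n m k (G : {mpoly A[k]})
    (V : 'I_k -> {mpoly A[m]}) (S : 'I_m -> {mpoly A[n]}) :
  G.[o V].[o S] = G.[o rcomp V S].
Proof.
rewrite [LHS]substE mmap_subst substE; apply: eq_mmap => // i.
by rewrite -substE.
Qed.

Lemma meval_subst (A : comNzRingType) n m (G : {mpoly A[m]})
    (F : 'I_m -> {mpoly A[n]}) t :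
  (G.[o F]).@[t] = G.@[fun i => (F i).@[t]].
Proof. exact: mmap_subst. Qed.

Lemma rcomp_homog (K : fieldType) n m k d e (G : 'I_k -> {mpoly K[m]})
   (F : 'I_m -> {mpoly K[n]}) :
  (forall i, F i \is d.-homog) -> (forall i, G i \is e.-homog) ->
  forall i, rcomp G F i \is (d * e).-homog.
Proof. by move=> Fd Ge i; apply: subst_homog. Qed.

Section Genericity.

Variables (K : fieldType) (A : idomainType) (f : {rmorphism K -> A}).

Definition generic n (h : 'I_n -> A) := forall p, mmap f h p = 0 -> p = 0.

(** A point of the projective plane over an extension of K that lies on no curve
    defined over K.  Such a point may fail to be [generic] as a vector: rescaling
    can make its coordinates dependent over K. *)
Definition avoids_curves n (a : 'I_n -> A) :=
  forall d (g : {mpoly K[n]}), g \is d.-homog -> g != 0 -> mmap f a g != 0.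

Lemma generic_avoids n (h : 'I_n -> A) : generic h -> avoids_curves h.
Proof. by move=> gh d g _; apply: contra_neq => /gh. Qed.

Lemma avoids_nonzero n m d (a : 'I_n -> A) (F : 'I_m -> {mpoly K[n]}) :
  avoids_curves a -> (forall i, F i \is d.-homog) -> nonzero F ->
  nonzero (fun i => mmap f a (F i)).
Proof. by move=> aa Fd [i Fi]; exists i; apply: (aa d). Qed.

(** If g(a) = 0, a relation G(W) = q g gives G(W(a)) = 0, hence G(W(h)) = 0 by
    homogeneity, and G = 0 by genericity of h: an image of a curve cannot reach
    the generic point of the plane. *)
Lemma fiber_avoids_curves D (W : 'I_3 -> {mpoly K[3]}) (a h : 'I_3 -> A) :
  (0 < D)%N -> (forall i, W i \is D.-homog) -> alg_independent W ->
  generic h -> proj_eq (fun i => mmap f a (W i)) (fun i => mmap f h (W i)) ->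
  avoids_curves a.
Proof.
move=> D0 Wd indW gh Wah d g gd g0; apply/eqP => ga0.
have [m [G [q [Gm G0 GW]]]] := form_relation_mod D0 Wd gd g0.
move/eqP: G0; apply; apply: indW; apply: gh.
rewrite mmap_subst; apply: (form_eq0 Gm Wah).
by rewrite -mmap_subst GW rmorphM /= ga0 mulr0.
Qed.

(** When P factors through S as rational maps, a fiber of S lies in a fiber of P.
    The factorization only holds up to common factors, which may vanish at
    particular points; a and h are on no curve, so they do not vanish there. *)
Lemma fiber_transfer n m k p s t (P : 'I_m -> {mpoly K[n]})
    (S : 'I_k -> {mpoly K[n]}) (T : 'I_m -> {mpoly K[k]}) (a h : 'I_n -> A) :
  (forall i, P i \is p.-homog) -> (forall i, S i \is s.-homog) ->
  (forall i, T i \is t.-homog) -> proj_eq P (rcomp T S) ->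
  avoids_curves a -> avoids_curves h ->
  proj_eq (fun i => mmap f a (S i)) (fun i => mmap f h (S i)) ->
  proj_eq (fun i => mmap f a (P i)) (fun i => mmap f h (P i)).
Proof.
move=> Pp Ss Tt PTS aa ah Sah.
have [P0 TS0 _] := PTS.
have TSh := rcomp_homog Ss Tt.
apply: (proj_eq_trans (v := fun i => mmap f a (rcomp T S i))).
  by apply: proj_eq_at => //; apply: avoids_nonzero; eauto.
apply: (proj_eq_trans (v := fun i => mmap f h (rcomp T S i))); last first.
  by apply: proj_eq_at; [exact: proj_eq_sym| |];
    apply: avoids_nonzero; eauto.
have E b i : mmap f b (rcomp T S i) = mmap f (fun j => mmap f b (S j)) (T i).
  by rewrite mmap_subst.
have [i] := avoids_nonzero aa TSh TS0; rewrite E => Ti.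
by apply: eq_proj_eq (proj_eq_forms Tt Sah (ex_intro _ i Ti)) => j; rewrite E.
Qed.

End Genericity.

(** A relation G(S) = 0 would put the image of S on a curve, and V maps this
    curve to dependent forms by [form_relation_mod]. *)
Lemma independent_source (K : fieldType) s r (S : 'I_3 -> {mpoly K[3]})
    (V : 'I_3 -> {mpoly K[3]}) :
  (forall i, S i \is s.-homog) -> (forall i, V i \is r.-homog) -> (0 < r)%N ->
  alg_independent (rcomp V S) -> (0 < s)%N /\ alg_independent S.
Proof.
move=> Ss Vr r0 indVS; apply: (alg_independent_forms Ss) => e G Ge GS.
apply/eqP; case: eqP => // /eqP G0.
have [m [G' [q [_ G'0 G'V]]]] := form_relation_mod r0 Vr Ge G0.
case/eqP: G'0; apply: indVS; rewrite -substA G'V.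
by rewrite rmorphM /= GS mulr0.
Qed.

(** A point where G o F, some F_k and X_0 are all nonzero would contradict the
    hypothesis. *)
Lemma vanishes_on_image (K : fieldType) n m (F : 'I_m -> {mpoly K[n.+1]})
    (G : {mpoly K[m]}) :
  points_detect K ->
  nonzero F ->
  (forall t, nonzero t -> nonzero (evalv F t) -> G.@[evalv F t] = 0) ->
  G.[o F] = 0.
Proof.
move=> detK [k Fk] GF0; apply/eqP; case: eqP => // /eqP GF.
have [t] := detK _ _ (mulf_neq0 (mulf_neq0 GF Fk) (X_neq0 K (ord0 : 'I_n.+1))).
rewrite !mevalM mevalXU !mulf_eq0 !negb_or -andbA => /and3P[/eqP GFt Fkt t0].
case: GFt; rewrite meval_subst; apply: GF0; first by exists ord0.
by exists k.
Qed.

(** This replaces the dimension of X.  A relation G(R o P) = 0 says that G o R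
    vanishes on the image of P, hence on X, hence on the image of B; but R o B
    is the identity. *)
Lemma dominant_independent (K : fieldType) (X : ('I_4 -> K) -> Prop)
    (B : 'I_4 -> {mpoly K[3]}) :
  points_detect K -> birational B X ->
  exists r (R : 'I_3 -> {mpoly K[4]}), (forall i, R i \is r.-homog) /\
    forall n p (P : 'I_4 -> {mpoly K[n]}), (forall i, P i \is p.-homog) ->
      dominant P X -> (0 < p * r)%N /\ alg_independent (rcomp R P).
Proof.
move=> detK [[_ B0] [BX _] [R [[[r Rr] R0] RB _ _]]].
exists r, R; split=> // n p P Pp [_ PX].
apply: (alg_independent_forms (rcomp_homog Pp Rr)) => e G Ge GRP.
have GR x : X x -> G.[o R].@[x] = 0.
  apply: PX => [|t _ _]; first by exists (r * e)%N; apply: subst_homog.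
  have -> : G.[o R].@[evalv P t] = (G.[o R].[o P]).@[t].
    by apply/esym; apply: meval_subst.
  by rewrite substA GRP meval0.
have := vanishes_on_image detK B0 (fun t t0 Bt => GR _ (BX t t0 Bt)).
rewrite substA substE => /(form_eq0 Ge RB).
by rewrite -substE comp_mpoly_id.
Qed.

(** * Subfields, minimal polynomials and conjugates *)

Lemma exists_minimizer (T : Type) (m : T -> nat) (A : T -> Prop) :
  (exists x, A x) -> exists x, A x /\ forall y, A y -> (m x <= m y)%N.
Proof.
move=> [x Ax]; have [n] := ubnP (m x); elim: n x Ax => // n IH x Ax mx.
have [[y [Ay my]]|H] := classic (exists y, A y /\ (m y < m x)%N).
  by apply: (IH y) => //; apply: leq_trans my _.
exists x; split=> // y Ay; rewrite leqNgt; apply/negP => my.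
by apply: H; exists y.
Qed.

Section Subfield.

Variables (M : fieldType) (S : divringClosed M).

Record subfield_of := Subfield { subfield_val :> M; _ : subfield_val \in S }.

HB.instance Definition _ := [isSub for subfield_val].
HB.instance Definition _ := [Choice of subfield_of by <:].
HB.instance Definition _ := [SubChoice_isSubIntegralDomain of subfield_of by <:].
HB.instance Definition _ := [SubIntegralDomain_isSubField of subfield_of by <:].

End Subfield.

Section SubfieldLift.

Variables (M : fieldType) (S : divringClosed M) (A : nzRingType).
Variables (g : {rmorphism A -> M}) (gS : forall a, g a \in S).

Definition subfield_lift a : subfield_of S := Subfield (gS a).

Fact subfield_lift_zmod : zmod_morphism subfield_lift.
Proof. by move=> a b; apply/val_inj; rewrite /= rmorphB. Qed.

Fact subfield_lift_monoid : monoid_morphism subfield_lift.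
Proof.
by split=> [|a b]; apply/val_inj; rewrite /= ?rmorph1 ?rmorphM.
Qed.

HB.instance Definition _ :=
  GRing.isZmodMorphism.Build A (subfield_of S) subfield_lift subfield_lift_zmod.
HB.instance Definition _ :=
  GRing.isMonoidMorphism.Build A (subfield_of S) subfield_lift
    subfield_lift_monoid.

Definition subfield_lift_rmorphism : {rmorphism A -> subfield_of S} :=
  subfield_lift.

End SubfieldLift.

(** A subfield given by a Prop-valued predicate becomes a subtype once the
    predicate is made boolean classically. *)
Section PropSubfield.

Variables (M : fieldType) (inE : M -> Prop).
Hypotheses (E1 : inE 1) (EB : forall x y, inE x -> inE y -> inE (x - y))
  (Ediv : forall x y, inE x -> inE y -> inE (x / y)).

Definition subfield_pred : pred M := fun x => excluded_middle_informative (inE x).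

Lemma subfield_predP x : reflect (inE x) (x \in subfield_pred).
Proof. by rewrite unfold_in; case: excluded_middle_informative => ?; constructor. Qed.

Fact subfield_pred_closed : divring_closed subfield_pred.
Proof.
split; first exact/subfield_predP.
- by move=> x y /subfield_predP Ex /subfield_predP Ey; apply/subfield_predP/EB.
- by move=> x y /subfield_predP Ex /subfield_predP Ey; apply/subfield_predP/Ediv.
Qed.

Lemma subfield_exists : exists (E : fieldType) (eps : {rmorphism E -> M}),
  (forall y, inE (eps y)) /\
  forall (A : nzRingType) (g : {rmorphism A -> M}), (forall a, inE (g a)) ->
    exists g' : {rmorphism A -> E}, forall a, eps (g' a) = g a.
Proof.
pose S : divringClosed M := HB.pack_for (divringClosed M) subfield_pred
  (GRing.isDivringClosed.Build M subfield_pred subfield_pred_closed).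
exists (subfield_of S), (val : {rmorphism subfield_of S -> M}).
split=> [y|A g gE]; first exact/subfield_predP/(valP y).
have gS a : g a \in S by apply/subfield_predP.
by exists (subfield_lift_rmorphism gS).
Qed.

End PropSubfield.

(** The subfield is made of the quotients of values of g; it is packaged as an
    abstract field with an embedding, since the polynomial gcds and the primitive
    element theorem used later need a field of coefficients. *)
Lemma subfield_generated (A : comNzRingType) (M : fieldType)
    (g : {rmorphism A -> M}) :
  exists (E : fieldType) (eps : {rmorphism E -> M}),
    (forall y, exists N D, g D != 0 /\ eps y * g D = g N) /\
    exists j : {rmorphism A -> E}, forall a, eps (j a) = g a.
Proof.
pose inE (x : M) := exists N D, g D != 0 /\ x * g D = g N.
have inE_g a : inE (g a) by exists a, 1; rewrite rmorph1 oner_neq0 mulr1.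
have E1 : inE 1 by rewrite -(rmorph1 g).
have EB x y : inE x -> inE y -> inE (x - y).
  move=> [N [D [D0 xD]]] [N' [D' [D'0 yD]]].
  exists (N * D' - N' * D), (D * D'); rewrite rmorphB !rmorphM mulf_neq0 //.
  by rewrite -xD -yD; split=> //; ring.
have Ediv x y : inE x -> inE y -> inE (x / y).
  move=> [N [D [D0 xD]]] [N' [D' [D'0 yD]]].
  have [->|y0] := eqVneq y 0.
    by exists 0, 1; rewrite invr0 mulr0 mul0r rmorph0 rmorph1 oner_neq0.
  exists (N * D'), (D * N'); rewrite !rmorphM -xD -yD !mulf_neq0 //.
  by split=> //; field.
have [E [eps [epsE liftE]]] := subfield_exists E1 EB Ediv.
by exists E, eps; split=> //; apply: liftE.
Qed.

Section MinimalPolynomial.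

Variables (E M : fieldType) (eps : {rmorphism E -> M}) (th : M).
Hypothesis char0 : [pchar E] =i pred0.
Local Notation "q ^e" := (map_poly eps q) (at level 2, format "q ^e").

(** In characteristic 0 the derivative of a minimal annihilator is a nonzero
    polynomial of smaller size, so their gcd is constant. *)
Lemma minimal_polynomial : algebraicOver eps th ->
  exists mu : {poly E}, [/\ mu != 0, root mu^e th, separable_poly mu &
    forall q, root q^e th -> mu %| q].
Proof.
move=> [q0 q00 q0th].
have [|mu [[mu0 muth] mu_min]] := @exists_minimizer _
    (fun q : {poly E} => size q) (fun q => q != 0 /\ root q^e th).
  by exists q0.
have mumin q : q != 0 -> root q^e th -> (size mu <= size q)%N.
  by move=> qn0 qth; apply: mu_min.
exists mu; split=> //; last first.
  move=> q qth; apply/modp_eq0P/eqP; case: eqP => // /eqP r0.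
  have := mumin _ r0; rewrite leqNgt ltn_modp mu0; apply.
  move: qth; rewrite {1}(divp_eq q mu) rmorphD rmorphM /root /=.
  by rewrite hornerD hornerM (rootP muth) mulr0 add0r.
have smu : (1 < size mu)%N.
  rewrite ltnNge; apply/negP => /size1_polyC muC; move: muth mu0.
  rewrite muC map_polyC rootC fmorph_eq0 => /eqP ->.
  by rewrite polyC0 eqxx.
have dmu0 : mu^`() != 0.
  apply/eqP => /polyP/(_ (size mu).-2); rewrite coef0 coef_deriv -mulr_natr.
  have -> : ((size mu).-2.+1 = (size mu).-1)%N by case: (size mu) smu => [|[]].
  move/eqP; rewrite mulf_eq0 lead_coef_eq0 (negPf mu0) /=.
  move/pcharf0P: char0 => ->; case: (size mu) smu => [|[]] //.
rewrite separable_poly.unlock coprimep_def; set g := gcdp _ _.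
have g0 : g != 0 by rewrite gcdp_eq0 (negPf mu0).
have := divpK (dvdp_gcdl mu mu^`()); rewrite -/g => mug.
have : root mu^e th by [].
rewrite -{1}mug rmorphM /= rootM => /orP[hth|gth].
  have h0 : mu %/ g != 0.
    by apply: contraNneq mu0 => h0; rewrite -mug h0 mul0r.
  have := mumin _ h0 hth; rewrite -{1}mug size_mul //.
  have := size_poly_gt0 g; rewrite g0; have := size_poly_gt0 (mu %/ g).
  by rewrite h0; clear; move: (size _) (size _) => a b; lia.
have := leq_ltn_trans (dvdp_leq dmu0 (dvdp_gcdr mu mu^`())) (lt_size_deriv mu0).
by rewrite ltnNge (mumin _ g0 gth).
Qed.

End MinimalPolynomial.

(** The ratios A_i(theta) : A_j(theta) are supposed to be invariant under
    conjugation of theta.  Reducing the A_i modulo the minimal polynomial,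
    A_j(theta) A_i(T) - A_i(theta) A_j(T) has lower degree and vanishes at all
    its roots, so it is zero; comparing coefficients at T^k for a k where the
    reduced A_i0 does not vanish gives the ratios as elements of E. *)
Lemma conjugates_descend (E M : fieldType) (L : closedFieldType)
    (eps : {rmorphism E -> M}) (iota : {rmorphism M -> L}) (th : M) n
    (A : 'I_n -> {poly E}) :
  [pchar E] =i pred0 -> algebraicOver eps th ->
  nonzero (fun i => (map_poly eps (A i)).[th]) ->
  (forall th' : L,
    (forall q, root (map_poly eps q) th ->
       root (map_poly (iota \o eps) q) th') ->
    forall i j, (map_poly (iota \o eps) (A i)).[th'] * iota (map_poly eps (A j)).[th]
      = (map_poly (iota \o eps) (A j)).[th'] * iota (map_poly eps (A i)).[th]) ->
  exists r : 'I_n -> E, nonzero r /\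
    forall i j, eps (r i) * (map_poly eps (A j)).[th]
              = eps (r j) * (map_poly eps (A i)).[th].
Proof.
move=> char0 alg [i0 Ai0] conj.
have [mu [mu0 muth sepmu dvdmu]] := minimal_polynomial char0 alg.
pose B i := A i %% mu.
have Bth i : (map_poly eps (B i)).[th] = (map_poly eps (A i)).[th].
  by rewrite [in RHS](divp_eq (A i) mu) rmorphD rmorphM /= hornerD hornerM
    (rootP muth) mulr0 add0r.
pose muL := map_poly (iota \o eps) mu.
have muL0 : muL != 0 by rewrite map_poly_eq0.
have [rs Ers] := closed_field_poly_normal muL.
have urs : uniq rs.
  have : separable_poly muL by rewrite separable_map.
  by rewrite Ers (eqp_separable (eqp_scale _ _)) ?lead_coef_eq0 //
    separable_prod_XsubC.
have srs : size muL = (size rs).+1.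
  by rewrite Ers size_scale ?lead_coef_eq0 // size_prod_XsubC.
have rsP x : x \in rs -> forall q, root (map_poly eps q) th ->
    root (map_poly (iota \o eps) q) x.
  move=> xrs q /dvdmu /(dvdpP _ _)[q' ->]; rewrite rmorphM rootM.
  by rewrite -/muL [X in _ || root X _]Ers rootZ ?lead_coef_eq0 // root_prod_XsubC xrs orbT.
have BA x i : x \in rs ->
    (map_poly (iota \o eps) (B i)).[x] = (map_poly (iota \o eps) (A i)).[x].
  move=> /rsP/(_ _ muth)/rootP mux.
  by rewrite [in RHS](divp_eq (A i) mu) rmorphD rmorphM /= hornerD hornerM
    mux mulr0 add0r.
have BB i j k : eps (B i)`_k * (map_poly eps (A j)).[th]
              = eps (B j)`_k * (map_poly eps (A i)).[th].
  pose D := iota (map_poly eps (A j)).[th] *: map_poly (iota \o eps) (B i)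
    - iota (map_poly eps (A i)).[th] *: map_poly (iota \o eps) (B j).
  have D0 : D = 0.
    apply/eqP; case: eqP => // /eqP Dn0.
    have sB l : (size (map_poly (iota \o eps) (B l)) < size muL)%N.
      by rewrite !size_map_poly ltn_modp.
    have : (size D < size muL)%N.
      apply: leq_ltn_trans (size_polyD _ _) _; rewrite size_polyN gtn_max.
      by rewrite !(leq_ltn_trans (size_scale_leq _ _) (sB _)).
    have := max_poly_roots Dn0 _ urs; rewrite srs ltnS => H.
    rewrite leqNgt H //; apply/allP => x xrs; apply/rootP.
    rewrite hornerD hornerN !hornerZ !BA // mulrC conj; last exact: rsP.
    by rewrite mulrC subrr.
  have := congr1 (fun p : {poly L} => p`_k) D0.
  rewrite coefB !coefZ !coef_map coef0 /= -!rmorphM => /eqP.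
  by rewrite subr_eq0 => /eqP/fmorph_inj; rewrite mulrC => ->; rewrite mulrC.
(* the leading coefficient of B i0 makes the tuple nonzero *)
exists (fun i => (B i)`_(size (B i0)).-1); split; last by move=> i j.
exists i0; rewrite lead_coef_eq0; apply: contraNneq Ai0 => B0.
by rewrite -Bth B0 rmorph0 horner0.
Qed.

Lemma primitive_element (E M : fieldType) (eps : {rmorphism E -> M}) n
    (x : 'I_n -> M) :
  [pchar E] =i pred0 -> (forall i, algebraicOver eps (x i)) ->
  exists th, algebraicOver eps th /\ exists g : 'I_n -> {poly E},
    forall i, (map_poly eps (g i)).[th] = x i.
Proof.
move=> char0; elim: n x => [|n IH] x algx.
  exists 0; split; first by rewrite -(rmorph0 eps); apply: algebraic_id.
  by exists (fun=> 0) => -[].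
have [//|th [algth [g gx]]] := IH (fun i => x (lift ord0 i)).
have [p p0 px] := algx ord0; have [q q0 qth] := algth.
have [k /= [[p' p'x] [q' q'th]]] := pchar0_PET p0 px q0 qth char0.
exists (th *+ k - x ord0); split.
  apply: algebraic_sub => //; rewrite -mulr_natr; apply: algebraic_mul => //.
  by rewrite -(rmorph_nat eps); apply: algebraic_id.
exists (fun i => if unlift ord0 i is Some j then g j \Po q' else p') => i.
case: unliftP => [j|] -> //.
by rewrite map_comp_poly horner_comp q'th gx.
Qed.

(** * Maps constant on the fibers of another map *)

Lemma tofrac_mpoly (K : fieldType) n (p : {mpoly K[n]}) :
  p%:F = mmap (@tofrac {mpoly K[n]} \o @mpolyC n K) (fun i => ('X_i)%:F) p.
Proof. exact: rmorph_mpoly (@tofrac {mpoly K[n]}) p. Qed.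

Lemma tofrac_subst (K : fieldType) n m (F : 'I_m -> {mpoly K[n]})
    (G : {mpoly K[m]}) :
  (G.[o F])%:F = mmap (@tofrac {mpoly K[n]} \o @mpolyC n K) (fun i => (F i)%:F) G.
Proof.
by rewrite substE (rmorph_mmap (@tofrac {mpoly K[n]})).
Qed.

(** The four forms W_1, W_2, W_3, X_i^D have the same degree, so they satisfy a
    nonzero relation; its coefficients as a polynomial in the last variable do
    not all vanish at W, since W is independent. *)
Lemma algebraic_over_independent (K : fieldType) (E : fieldType)
    (eps : {rmorphism E -> {fraction {mpoly K[3]}}}) D
    (W : 'I_3 -> {mpoly K[3]}) i :
  (0 < D)%N -> (forall i, W i \is D.-homog) -> alg_independent W ->
  (exists phi : {rmorphism {mpoly K[3]} -> E},
     forall G, eps (phi G) = (G.[o W])%:F) ->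
  algebraicOver eps ('X_i)%:F.
Proof.
move=> D0 WD indW [phi phiE].
pose F : 'I_4 -> {mpoly K[3]} := extend W ('X_i ^+ D).
have FD j : F j \is D.-homog.
  rewrite /F /extend; case: unliftP => [k|] _ //.
  by rewrite -{2}[D]mul1n; apply: dhomogMn; rewrite dhomogX /= mdeg1.
have [G G0 GF] := form_relation D0 FD.
have mG0 : muni G != 0 by rewrite -(muni0 3 K) (inj_eq (@muni_inj _ _)).
pose q := map_poly phi (muni G).
have phi_inj H : phi H = 0 -> H = 0.
  by move/(congr1 eps); rewrite phiE rmorph0 => /eqP; rewrite tofrac_eq0 => /eqP/indW.
have q0 : q != 0.
  apply: contraNneq mG0 => /(congr1 (fun p : {poly E} => p`_(size (muni G)).-1)).
  by rewrite coef_map coef0 => /phi_inj/eqP; rewrite lead_coef_eq0.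
exists (q \Po 'X^D); first by rewrite comp_poly_eq0 // size_polyXn.
rewrite /root map_comp_poly horner_comp map_polyXn hornerXn.
rewrite /q -map_poly_comp -rmorphXn /=; apply/eqP.
transitivity (G.[o F])%:F; last by rewrite GF rmorph0.
rewrite tofrac_subst (horner_muni (@tofrac {mpoly K[3]} \o @mpolyC 3 K)) /F extend_max.
congr horner; apply: eq_map_poly => H /=; rewrite phiE tofrac_subst.
by apply: eq_mmap => // k; rewrite extend_widen.
Qed.

Lemma pihomog_mulr (R : comNzRingType) n d e (p q : {mpoly R[n]}) :
  q \is e.-homog -> pihomog mdeg (d + e) (p * q) = pihomog mdeg d p * q.
Proof.
move=> qe; rewrite {1}[p]mpolyE [in RHS]pihomogE mulr_suml linear_sum /=.
rewrite [in RHS]big_mkcond mulr_suml /=; apply: eq_bigr => mu _.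
rewrite -!scalerAl linearZ /=.
have hX : 'X_[mu] * q \is (mdeg mu + e).-homog.
  by apply: dhomogM => //; rewrite dhomogX.
case: eqP => [<-|ne]; first by rewrite pihomog_dE // scalerAl.
rewrite (pihomog_ne0 _ hX) ?scaler0 ?mul0r //.
by rewrite eqn_add2r; apply/eqP.
Qed.

Section GenericPoint.

Variables (K : fieldType) (L : fieldType)
  (iota : {rmorphism {fraction {mpoly K[3]}} -> L}).

Definition constL : {rmorphism K -> L} :=
  iota \o (@tofrac {mpoly K[3]} \o @mpolyC 3 K).

Definition genericL (i : 'I_3) : L := iota ('X_i)%:F.

Lemma genericL_eval p : mmap constL genericL p = iota p%:F.
Proof. by rewrite tofrac_mpoly (rmorph_mmap iota). Qed.

Lemma genericL_generic : generic constL genericL.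
Proof.
by move=> p; rewrite genericL_eval => /eqP; rewrite fmorph_eq0 tofrac_eq0 => /eqP.
Qed.

End GenericPoint.

(** With E the field generated by the P_i(h), theta a primitive element of E(h)
    over E and h = g(theta), the points g(theta') for theta' conjugate to theta
    lie in the fiber of P through h, so [conjugates_descend] applies to
    A_i = S_i(g).  Independence of R_0 o P makes h algebraic over E. *)
Lemma fiber_inclusion_descends (K : fieldType) (L : closedFieldType)
    (iota : {rmorphism {fraction {mpoly K[3]}} -> L}) m n p r s
    (P : 'I_m -> {mpoly K[3]}) (R0 : 'I_3 -> {mpoly K[m]})
    (S : 'I_n -> {mpoly K[3]}) :
  [pchar K] =i pred0 ->
  (forall i, P i \is p.-homog) -> (forall i, R0 i \is r.-homog) ->
  (0 < p * r)%N -> alg_independent (rcomp R0 P) -> nonzero P ->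
  (forall i, S i \is s.-homog) -> nonzero S ->
  (forall a, generic_fiber iota P a -> generic_fiber iota S a) ->
  exists e (R : 'I_n -> {mpoly K[m]}), (forall i, R i \is e.-homog) /\
    proj_eq (rcomp R P) S.
Proof.
move=> char0 Pp Rr pr0 indRP [iP PiP] Ss [iS SiS] PS.
have p0 : (0 < p)%N by move: pr0; rewrite muln_gt0 => /andP[].
pose M := {fraction {mpoly K[3]}}.
(* E is the field of quotients of polynomials in P *)
have [E [eps [epsE [j jE]]]] :=
  subfield_generated (@tofrac {mpoly K[3]} \o comp_mpoly [tuple P j | j < m]).
rewrite /= in epsE jE.
have charE : [pchar E] =i pred0.
  apply/pcharf0P => q; rewrite -(fmorph_eq0 eps) rmorph_nat.
  rewrite -(rmorph_nat (@tofrac {mpoly K[3]} \o @mpolyC 3 K)) /=.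
  by rewrite tofrac_eq0 mpolyC_eq0; move/pcharf0P: char0 => ->.
have algX i : algebraicOver eps ('X_i)%:F.
  apply: (algebraic_over_independent _ pr0 (rcomp_homog Pp Rr) indRP).
  exists (j \o comp_mpoly [tuple R0 l | l < 3]) => G /=.
  by rewrite jE substA.
have [th [algth [g gX]]] := primitive_element charE algX.
pose kE : {rmorphism K -> {poly E}} := polyC \o (j \o @mpolyC m K).
pose A (F : {mpoly K[3]}) := mmap kE g F.
have Ath F : (map_poly eps (A F)).[th] = F%:F.
  transitivity ((horner_eval th \o map_poly eps) (A F)); first by [].
  rewrite (rmorph_mmap (horner_eval th \o map_poly eps)) tofrac_mpoly.
  apply: eq_mmap => [c|i] /=; last by rewrite /horner_eval gX.
  by rewrite map_polyC /horner_eval hornerC /= jE comp_mpolyC.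
have AL F (th' : L) : (map_poly (iota \o eps) (A F)).[th'] =
    mmap (constL iota) (fun i => (map_poly (iota \o eps) (g i)).[th']) F.
  transitivity ((horner_eval th' \o map_poly (iota \o eps)) (A F)); first by [].
  rewrite (rmorph_mmap (horner_eval th' \o map_poly (iota \o eps))).
  apply: eq_mmap => [c|i] //=.
  by rewrite map_polyC /horner_eval hornerC /= jE comp_mpolyC.
have [|th' conj|rr [[k rrk] rS]] :=
  @conjugates_descend E M L eps iota th n (fun i => A (S i)) charE algth.
- by exists iS; rewrite Ath tofrac_eq0.
- pose a i := (map_poly (iota \o eps) (g i)).[th'].
  (* P_i(g(T)) - P_i(h) has coefficients in E and vanishes at theta *)
  have Pa i : mmap (constL iota) a (P i) = iota (P i)%:F.
    pose q := A (P i) - (j 'X_i)%:P.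
    have : root (map_poly eps q) th.
      rewrite /root rmorphB /= map_polyC hornerD hornerN hornerC Ath /= jE.
      by rewrite substE mmapXU subrr.
    move/conj; rewrite /root rmorphB /= map_polyC hornerD hornerN hornerC AL /= jE.
    by rewrite substE mmapXU subr_eq0 => /eqP.
  have [|a0 [_ _ Sa]] := PS a.
    split; last first.
      split.
      - exists iP; rewrite /evalL -[X in X != 0]/(mmap (constL iota) a (P iP)).
        by rewrite Pa fmorph_eq0 tofrac_eq0.
      - exists iP; rewrite /evalL.
        rewrite -[X in X != 0]/(mmap (constL iota) (genericL iota) (P iP)).
        by rewrite genericL_eval fmorph_eq0 tofrac_eq0.
      - move=> i l; rewrite /evalL.
        rewrite -!/(mmap (constL iota) a _) -!/(mmap (constL iota) (genericL iota) _).
        by rewrite !Pa !genericL_eval mulrC.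
    (* P has positive degree, so it vanishes at the zero vector *)
    apply: NNPP => a0; have az i : a i = 0.
      by apply/eqP; case: eqP => // /eqP ai; case: a0; exists i.
    have := Pa iP; rewrite (eq_mmap (f' := constL iota) (h' := fun i => 0 * a i)).
    + rewrite (mmap_homogZ _ _ _ (Pp iP)) expr0n (gtn_eqF p0) mul0r => /esym/eqP.
      by rewrite fmorph_eq0 tofrac_eq0 (negPf PiP).
    + by [].
    + by move=> i; rewrite mul0r az.
  move=> i l; rewrite !Ath !AL -!genericL_eval; exact: Sa.
have [N /fin_all_exists[D ND]] := fin_all_exists (fun i => epsE (rr i)).
have cross i l : eps (rr i) * (S l)%:F = eps (rr l) * (S i)%:F.
  by have := rS i l; rewrite !Ath.
(* clear the denominators D, then take the component of degree e *)
pose Q i := N i * \prod_(l < n | l != i) D l.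
pose DD := (\prod_(l < n) D l).[o P].
have DD0 : DD != 0.
  rewrite /DD (rmorph_prod (comp_mpoly _)); apply/prodf_neq0 => l _.
  by case: (ND l); rewrite tofrac_eq0.
have QE i : ((Q i).[o P])%:F = eps (rr i) * DD%:F.
  rewrite /DD (bigD1 i) //= /Q !rmorphM /=.
  by case: (ND i) => _ <-; rewrite mulrA.
have QS i l : (Q i).[o P] * S l = (Q l).[o P] * S i.
  apply/eqP; rewrite -tofrac_eq !tofracM !QE; apply/eqP.
  by rewrite mulrAC cross mulrAC.
have Qk : (Q k).[o P] != 0.
  by rewrite -tofrac_eq0 QE mulf_neq0 ?fmorph_eq0 // tofrac_eq0.
have [e Qe] : exists e, (pihomog mdeg e (Q k)).[o P] != 0.
  apply: NNPP => H; case/eqP: Qk; apply: pihomog_eq0 => d.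
  rewrite (pihomog_partitionE (leqnn (msize (Q k)))).
  rewrite (rmorph_sum (comp_mpoly _)) linear_sum big1 // => e _ /=.
  have [->|ne] := eqVneq (pihomog mdeg e (Q k)).[o P] 0; first by rewrite pihomog0.
  by case: H; exists e.
exists e, (fun i => pihomog mdeg e (Q i)); split=> [i|]; first exact: pihomogP.
have cr i l : (pihomog mdeg e (Q i)).[o P] * S l = (pihomog mdeg e (Q l)).[o P] * S i.
  by rewrite !(pihomog_subst _ _ p0 Pp) -!(pihomog_mulr _ _ (Ss _)) QS.
by split; [exists k | exists iS | move=> i l; rewrite cr mulrC].
Qed.

(** * Polynomial rings are factorial *)

Definition divides (R : idomainType) (a b : R) : Prop := exists c, b = c * a.

Definition prime_elt (R : idomainType) (p : R) : Prop :=
  [/\ p != 0, p \isn't a GRing.unit &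
      forall a b, divides p (a * b) -> divides p a \/ divides p b].

(** Uniqueness of the factorization is contained in the factors being prime. *)
Definition factorial_ring (R : idomainType) : Prop :=
  forall x : R, x != 0 -> exists u s,
    [/\ u \is a GRing.unit, forall p, p \in s -> prime_elt p &
        x = u * \prod_(p <- s) p].

Section Divisibility.

Variable R : idomainType.
Implicit Types a b c p q u x y : R.

Lemma dividesD a b c : divides a b -> divides a c -> divides a (b + c).
Proof. by move=> [x ->] [y ->]; exists (x + y); rewrite mulrDl. Qed.

Lemma divides_mull a b c : divides a b -> divides a (c * b).
Proof. by move=> [x ->]; exists (c * x); rewrite mulrA. Qed.

Lemma divides_trans a b c : divides a b -> divides b c -> divides a c.
Proof. by move=> [x ->] [y ->]; exists (y * x); rewrite mulrA. Qed.

Lemma prime_mulu u p : u \is a GRing.unit -> prime_elt p -> prime_elt (u * p).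
Proof.
move=> uu [p0 pu pp].
have up a : divides p a -> divides (u * p) a.
  by move=> [c ->]; exists (c * u^-1); rewrite -mulrA mulKr.
split=> [||a b].
  by rewrite mulf_neq0 //; apply: contraTneq uu => ->; rewrite unitr0.
  by rewrite unitrM uu.
move=> [c abE]; have /pp[] : divides p (a * b) by exists (c * u); rewrite abE mulrA.
- by left; apply: up.
- by right; apply: up.
Qed.

Lemma prime_not_dvd_unit p u : prime_elt p -> u \is a GRing.unit -> ~ divides p u.
Proof.
by move=> [_ pu _] uu [c uE]; move: pu; apply/negP/negPn; move: uu;
  rewrite uE unitrM => /andP[].
Qed.

Lemma prime_dvd_prod p s : prime_elt p -> divides p (\prod_(q <- s) q) ->
  exists2 q, q \in s & divides p q.
Proof.
move=> pp; elim: s => [|q s IH].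
  by rewrite big_nil => /(prime_not_dvd_unit pp (unitr1 _)).
have [_ _ pprime] := pp; rewrite big_cons => /pprime[pq|/IH[r rs pr]].
  by exists q; rewrite ?mem_head.
by exists r => //; rewrite inE rs orbT.
Qed.

Lemma prime_dvd_prime p q : prime_elt p -> prime_elt q -> divides p q ->
  exists2 u, u \is a GRing.unit & q = u * p.
Proof.
move=> [p0 pu pp] [q0 qu qp] [c qE].
have [[d cE]|[d pE]] : divides q c \/ divides q p.
- by apply: qp; exists 1; rewrite mul1r.
- case/negP: pu; apply/unitrP; exists d.
  have : (d * p) * q = 1 * q by rewrite mul1r {2}qE cE mulrAC.
  by move/(mulIf q0) => dp; rewrite (mulrC p) dp.
- exists c => //; apply/unitrP; exists d.
  have : (d * c) * p = 1 * p by rewrite mul1r -mulrA -qE -pE.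
  by move/(mulIf p0) => dp; rewrite (mulrC c) dp.
Qed.

Lemma factorial_irreducible_prime x : factorial_ring R ->
  x != 0 -> x \isn't a GRing.unit ->
  (forall a b, x = a * b -> a \is a GRing.unit \/ b \is a GRing.unit) ->
  prime_elt x.
Proof.
move=> UFD x0 xu xirr; have [u [[|q s] [uu sp xE]]] := UFD _ x0.
  by move: xu; rewrite xE big_nil mulr1 uu.
have qp : prime_elt q by apply: sp; rewrite mem_head.
have [_ /negP qu _] := qp; rewrite big_cons mulrCA in xE.
have [//|vu] := xirr _ _ xE.
by rewrite xE mulrC; apply: prime_mulu.
Qed.

End Divisibility.

Section Gauss.

Variable R : idomainType.
Hypothesis UFD : factorial_ring R.
Implicit Types (p c : R) (f g a b : {poly R}).

Definition primitive f := forall p, prime_elt p -> ~ divides p%:P f.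

Lemma dividesC_coef p f i : divides p%:P f -> divides p f`_i.
Proof. by move=> [c ->]; exists c`_i; rewrite coefMC. Qed.

(** If p divides neither leading coefficient it does not divide that of the
    product; otherwise the divisible leading term may be removed. *)
Lemma prime_polyC p : prime_elt p -> prime_elt p%:P.
Proof.
move=> pp; have [p0 pu pprime] := pp.
split; rewrite ?polyC_eq0 ?poly_unitE ?size_polyC ?p0 ?coefC //.
move=> a b; have [n] := ubnP (size a + size b).
elim: n a b => // n IH a b sab pab.
have [->|a0] := eqVneq a 0; first by left; exists 0; rewrite mul0r.
have [->|b0] := eqVneq b 0; first by right; exists 0; rewrite mul0r.
have drop f : f != 0 -> divides p (lead_coef f) -> exists2 f' : {poly R},
    (size f' < size f)%N & divides p%:P (f - f').
  move=> f0 [c fE]; exists (f - lead_coef f *: 'X^((size f).-1)).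
    rewrite -[ltnRHS]prednK ?size_poly_gt0 // ltnS.
    apply/leq_sizeP => j jf; rewrite coefB coefZ coefXn.
    move: jf; rewrite leq_eqVlt => /predU1P[<-|jf].
      by rewrite eqxx mulr1 subrr.
    rewrite (gtn_eqF jf) mulr0 subr0 nth_default //.
    by rewrite -(prednK (_ : 0 < size f)%N) ?size_poly_gt0.
  exists (c *: 'X^((size f).-1)); rewrite subKr fE -!mul_polyC polyCM.
  by rewrite mulrAC.
have /pprime[pa|pb] : divides p (lead_coef a * lead_coef b).
- by rewrite -lead_coefM; apply: dividesC_coef.
- have [a' sa' pa'] := drop a a0 pa.
  have [||pa''|pb''] := IH a' b; first by lia.
  + have -> : a' * b = a * b + (- b) * (a - a') by ring.
    by apply: dividesD => //; apply: divides_mull.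
  + by left; rewrite -(subrK a' a); apply: dividesD.
  + by right.
- have [b' sb' pb'] := drop b b0 pb.
  have [||pa''|pb''] := IH a b'; first by lia.
  + have -> : a * b' = a * b + (- a) * (b - b') by ring.
    by apply: dividesD => //; apply: divides_mull.
  + by left.
  + by right; rewrite -(subrK b' b); apply: dividesD.
Qed.

(** Gauss lemma: the prime factors of c divide w, because they do not divide f. *)
Lemma primitive_cancel f a c w :
  primitive f -> c != 0 -> c%:P * a = w * f -> divides f a.
Proof.
move=> fprim /UFD[u [s [uu sp ->]]]; elim: s w a sp => [|p s IH] w a sp.
  rewrite big_nil mulr1 => ua; exists ((u^-1)%:P * w).
  by rewrite -mulrA -ua mulrA -polyCM mulVr // mul1r.
have pp : prime_elt p by apply: sp; rewrite mem_head.
rewrite big_cons mulrCA polyCM -mulrA => E.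
have [_ _ pprime] := prime_polyC pp.
have /pprime[[w' wE]|/fprim] : divides p%:P (w * f).
- by exists ((u * \prod_(q <- s) q)%:P * a); rewrite -E mulrC.
- apply: (IH w'); first by move=> q qs; apply: sp; rewrite inE qs orbT.
  apply: (@mulfI _ p%:P); first by case: (prime_polyC pp).
  by rewrite E wE mulrAC mulrC.
- by case.
Qed.

(** Each prime extracted from f removes one factor from the leading
    coefficient, so the process stops. *)
Lemma content_primitive f : f != 0 -> exists s f',
  [/\ forall p, p \in s -> prime_elt p, primitive f' &
      f = (\prod_(p <- s) p)%:P * f'].
Proof.
move=> f0; have lf0 : lead_coef f != 0 by rewrite lead_coef_eq0.
have [u [t [uu tp fE]]] := UFD lf0.
have [n] := ubnP (size t); elim: n f f0 lf0 t u uu tp fE => // n IH.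
move=> f f0 lf0 t u uu tp fE st.
have [fprim|] := classic (primitive f).
  by exists [::], f; split=> //; rewrite big_nil mul1r.
move=> fnprim; have [p Hp] := not_all_ex_not _ _ fnprim.
have [pp /NNPP[g gE]] := imply_to_and _ _ Hp.
have [_ _ pprime] := pp.
have lE : lead_coef f = lead_coef g * p by rewrite gE lead_coefM lead_coefC.
have [q qt pq] : exists2 q, q \in t & divides p q.
  apply: prime_dvd_prod => //.
  have /pprime[|//] : divides p (u * \prod_(q <- t) q).
    by rewrite -fE lE; exists (lead_coef g).
  by move/(prime_not_dvd_unit pp uu).
have [v vu qE] := prime_dvd_prime pp (tp _ qt) pq.
have p0 : p != 0 by case: pp.
have g0 : g != 0 by apply: contraNneq f0 => g0; rewrite gE g0 mul0r.
have [|||||s [f' [sp fp gE']]] := IH g g0 _ (rem q t) (u * v).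
- by rewrite lead_coef_eq0.
- by rewrite unitrM uu.
- by move=> r /mem_rem; apply: tp.
- apply: (mulIf p0); rewrite -lE fE (perm_big _ (perm_to_rem qt)) big_cons.
  by set X := \prod_(j <- rem q t) j; rewrite /= qE; ring.
- rewrite size_rem //; case: (t) qt st => //.
exists (p :: s), f'; split=> //.
- by move=> r; rewrite inE => /predU1P[->|/sp].
- by rewrite gE gE' big_cons polyCM; ring.
Qed.

Lemma primitive_const f : primitive f -> size f = 1%N -> f \is a GRing.unit.
Proof.
move=> fprim sf; have /size_poly1P[c c0 fE] : size f == 1%N by rewrite sf.
have [u [[|p s] [uu sp cE]]] := UFD c0.
  by rewrite poly_unitE sf eqxx fE coefC cE big_nil mulr1.
case: (fprim p); first by apply: sp; rewrite mem_head.
by exists (u * \prod_(q <- s) q)%:P; rewrite fE cE big_cons mulrCA [RHS]mulrC polyCM.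
Qed.

Lemma primitive_divisor f g : primitive f -> divides g f -> primitive g.
Proof. by move=> fprim gf p pp pg; apply: (fprim p pp); apply: divides_trans gf. Qed.

(** Suppose f divides a b.  If the resultant r of f and a is nonzero, it is a
    combination of f and a, so f divides r b, and r can be cancelled.  If it is
    zero, the primitive part of the gcd of f and a is a nonconstant divisor of
    f, hence an associate of f that divides a. *)
Lemma primitive_irreducible_prime f : primitive f -> (1 < size f)%N ->
  (forall a b, f = a * b -> a \is a GRing.unit \/ b \is a GRing.unit) ->
  prime_elt f.
Proof.
move=> fprim sf firr.
have f0 : f != 0 by rewrite -size_poly_gt0; apply: leq_trans sf.
split=> // [|a b [w abE]]; first by rewrite poly_unitE (gtn_eqF sf).
have [->|a0] := eqVneq a 0; first by left; exists 0; rewrite mul0r.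
case: (leqP (size a) 1) => [sa|sa].
  right; have aC := size1_polyC sa; rewrite aC in abE a0.
  by apply: (primitive_cancel fprim _ abE); rewrite -polyC_eq0.
have [r0|r0] := eqVneq (resultant f a) 0; last first.
  right; have [[u v] /= [_ _] rE] := resultant_in_ideal sf sa.
  apply: (primitive_cancel (w := u * b + v * w) fprim r0).
  by rewrite rE; rewrite mulrDl -!mulrA abE; ring.
left; have := resultant_eq0 f a; rewrite r0 eqxx => /esym sg.
set g := gcdp f a in sg.
have g0 : g != 0 by rewrite -size_poly_gt0; apply: leq_trans sg.
have [s [g' [sp gprim gE]]] := content_primitive g0.
have dvd h : (g %| h)%R -> divides g' h.
  move=> /Pdiv.Idomain.dvdpP[[c q] /= c0 cE].
  apply: (primitive_cancel (c := c) (w := q * (\prod_(p <- s) p)%:P)) => //.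
  by rewrite mul_polyC cE {1}gE mulrA.
have [h fE] := dvd f (dvdp_gcdl _ _).
have [hu|] := firr _ _ fE; last first.
  have s0 : \prod_(p <- s) p != 0.
    by apply: contraNneq g0 => s0; rewrite gE s0 mul0r.
  have : size g = size g' by rewrite gE mul_polyC size_scale.
  by rewrite poly_unitE => sgg /andP[/eqP sg1]; rewrite sgg sg1 in sg.
apply: divides_trans (dvd a (dvdp_gcdr _ _)).
by exists h^-1; rewrite fE mulKr.
Qed.

(** Extract the content, then split the primitive part as long as it is
    reducible; both factors are primitive, hence of smaller degree. *)
Lemma factorial_poly : factorial_ring {poly R}.
Proof.
have prim f : f != 0 -> primitive f -> exists u s,
    [/\ u \is a GRing.unit, forall p : {poly R}, p \in s -> prime_elt p &
        f = u * \prod_(p <- s) p].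
  have [n] := ubnP (size f); elim: n f => // n IH f sf f0 fprim.
  have sf0 : (0 < size f)%N by rewrite size_poly_gt0.
  have [s1|s1] := eqVneq (size f) 1%N.
    by exists f, [::]; rewrite big_nil mulr1 primitive_const.
  have {s1}s1 : (1 < size f)%N by case: (size f) sf0 s1 => [|[]].
  have [irr|] := classic (forall a b, f = a * b -> a \is a GRing.unit \/ b \is a GRing.unit).
    exists 1, [:: f]; rewrite unitr1 mul1r big_seq1; split=> // p.
    by rewrite inE => /eqP ->; apply: primitive_irreducible_prime.
  move=> nirr; have [a Ha] := not_all_ex_not _ _ nirr.
  have [b Hb] := not_all_ex_not _ _ Ha.
  have [fE Hu] := imply_to_and _ _ Hb; have [au bu] := not_or_and _ _ Hu.
  have [a0 b0] : a != 0 /\ b != 0.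
    by move: f0; rewrite fE mulf_eq0 negb_or => /andP.
  have aprim : primitive a.
    by apply: primitive_divisor fprim _; exists b; rewrite mulrC.
  have bprim : primitive b by apply: primitive_divisor fprim _; exists a.
  have big g : g != 0 -> primitive g -> ~ g \is a GRing.unit -> (1 < size g)%N.
    move=> g0 gprim gu; rewrite ltn_neqAle eq_sym size_poly_gt0 g0 andbT.
    by apply/eqP => /(primitive_const gprim).
  have sab : size f = (size a + size b).-1 by rewrite fE size_mul.
  have sa := big _ a0 aprim au; have sb := big _ b0 bprim bu.
  have [|u [s [uu sp aE]]] := IH a _ a0 aprim; first by lia.
  have [|v [t [vu tp bE]]] := IH b _ b0 bprim; first by lia.
  exists (u * v), (s ++ t); rewrite unitrM uu vu big_cat /=; split=> //.
    by move=> p; rewrite mem_cat => /orP[/sp|/tp].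
  by rewrite fE aE bE; ring.
move=> f f0; have [s [f' [sp fprim fE]]] := content_primitive f0.
have f'0 : f' != 0 by apply: contraNneq f0 => f'0; rewrite fE f'0 mulr0.
have [u [t [uu tp f'E]]] := prim f' f'0 fprim.
exists u, ([seq p%:P | p <- s] ++ t); split=> //.
  move=> p; rewrite mem_cat => /orP[/mapP[q qs ->]|/tp //].
  by apply: prime_polyC; apply: sp.
by rewrite big_cat big_map /= -rmorph_prod mulrCA -f'E fE.
Qed.

End Gauss.

Lemma factorial_iso (R R' : idomainType) (phi : {rmorphism R -> R'})
    (psi : R' -> R) :
  cancel phi psi -> cancel psi phi -> factorial_ring R' -> factorial_ring R.
Proof.
move=> phiK psiK UFD x x0; have phi_inj := can_inj phiK.
have unit_psi y : psi y \is a GRing.unit = (y \is a GRing.unit).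
  apply/idP/idP => [/(rmorph_unit phi)|yu]; first by rewrite psiK.
  apply/unitrP; exists (psi y^-1).
  by split; apply: phi_inj; rewrite rmorphM !psiK rmorph1 ?mulVr ?divrr.
have [|u [s [uu sp xE]]] := UFD (phi x).
  by rewrite -(rmorph0 phi) (inj_eq phi_inj).
exists (psi u), [seq psi p | p <- s]; rewrite unit_psi; split=> //; last first.
  apply: phi_inj; rewrite xE rmorphM psiK rmorph_prod big_map; congr (_ * _).
  by apply: eq_bigr => p _; rewrite psiK.
move=> _ /mapP[p /sp[p0 pu pp] ->]; split; rewrite ?unit_psi //.
  by rewrite -(inj_eq phi_inj) psiK rmorph0.
have dvd a : divides p (phi a) -> divides (psi p) a.
  by move=> [c cE]; exists (psi c); apply: phi_inj; rewrite cE rmorphM !psiK.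
move=> a b [c abE]; have /pp[] : divides p (phi a * phi b).
- by exists (phi c); rewrite -rmorphM abE rmorphM psiK.
- by left; apply: dvd.
- by right; apply: dvd.
Qed.

Lemma factorial_mpoly (K : fieldType) n : factorial_ring {mpoly K[n]}.
Proof.
elim: n => [|n IH].
  move=> p p0; exists p, [::]; rewrite big_nil mulr1; split=> //.
  have c0 : p@_0%MM != 0.
    by apply: contraNneq p0 => c0; rewrite [p]nvar0_mpolyC c0 mpolyC0.
  apply/unitrP; exists ((p@_0%MM)^-1)%:MP; rewrite {2 3}[p]nvar0_mpolyC.
  by rewrite -!mpolyCM mulVf // mulfV.
have muniK : cancel (@muni n K) (@mmulti n K).
  by move=> p; apply: muni_inj; rewrite mmultiK.
exact: factorial_iso muniK (@mmultiK _ _) (factorial_poly IH).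
Qed.

(** * Affine charts and surfaces linear in z *)

(** G(x_1,..,x_n) w^N with the denominators of x_i = y_i/w cleared; the identity
    holds in every commutative K-algebra, so that it can be used over K, over
    polynomial rings and over their fraction fields. *)
Lemma homogenize (K : fieldType) n (G : {mpoly K[n]}) :
  exists N (Gh : {mpoly K[n.+1]}), Gh \is N.-homog /\
    forall (A : comNzRingType) (f : {rmorphism K -> A}) (u : 'I_n -> A) w,
      mmap f (extend (fun i => w * u i) w) Gh = w ^+ N * mmap f u G.
Proof.
exists (msize G).
exists (\sum_(m <- msupp G) G@_m *:
  ('X_[mnmwiden m] * 'X_ord_max ^+ (msize G - mdeg m))); split.
  rewrite big_seq rpred_sum // => m /msize_mdeg_lt/ltnW mG; apply: rpredZ.
  have hm : ('X_[mnmwiden m] : {mpoly K[n.+1]}) \is (mdeg m).-homog .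
    rewrite dhomogX /= mdegE big_ord_recr /= mnmwiden_ordmax addn0 mdegE.
    by apply/eqP/eq_bigr => i _; rewrite mnmwiden_widen.
  have hX : ('X_ord_max : {mpoly K[n.+1]}) \is 1.-homog by rewrite dhomogX /= mdeg1.
  by have := dhomogM hm (dhomogMn (msize G - mdeg m) hX); rewrite mul1n subnKC.
move=> A f u w; rewrite (rmorph_sum (mmap f _)) [mmap f u G]/mmap mulr_sumr.
rewrite big_seq [RHS]big_seq /=; apply: eq_bigr => m /msize_mdeg_lt/ltnW mG.
rewrite mmapZ rmorphM rmorphXn /= mmapXU extend_max [RHS]mulrCA; congr (_ * _).
rewrite -[in RHS](subnKC mG) exprD [RHS]mulrAC; congr (_ * _).
rewrite -(mmapX u f) -(mmap_homogZ f w u (p := 'X_[m])) ?dhomogX //.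
rewrite -mwidenX /mwiden (rmorph_mmap (mmap f _)).
by apply: eq_mmap => [c|i] /=; rewrite ?mmapC // mmapXU extend_widen.
Qed.

(** The identity of [homogenize] read from a ternary form to its
    dehomogenization. *)
Lemma homog_dehom (K : fieldType) d (F : {mpoly K[3]}) (A : comNzRingType)
    (f : {rmorphism K -> A}) (u : 'I_2 -> A) w :
  F \is d.-homog ->
  mmap f (extend (fun i => w * u i) w) F = w ^+ d * mmap f u (dehom F).
Proof.
move=> Fd; rewrite /dehom /comp_mpoly (rmorph_mmap (mmap f u)).
rewrite -(mmap_homogZ (mmap f u \o @mpolyC 2 K) _ _ Fd).
apply: eq_mmap => [c|i] /=; first by rewrite mmapC.
case: i => [[|[|[|i]]] lt] //=; rewrite /extend.
- by case: unliftP => [j|] /(congr1 val) //=; rewrite (tnth_nth 0) /= mmapXU; case: j => [[|[|j]]] //= ? _; congr (w * u _); apply/val_inj.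
- by case: unliftP => [j|] /(congr1 val) //=; rewrite (tnth_nth 0) /= mmapXU; case: j => [[|[|j]]] //= ? _; congr (w * u _); apply/val_inj.
- case: unliftP => [j|] /(congr1 val) //=; last first.
    by rewrite (tnth_nth 0) /= rmorph1 mulr1.
  by rewrite /bump; case: j => [[|[|j]]].
Qed.

Definition constF (K : fieldType) n : {rmorphism K -> {fraction {mpoly K[n]}}} :=
  @tofrac {mpoly K[n]} \o @mpolyC n K.

Definition affine_coord (K : fieldType) (i : 'I_2) : {fraction {mpoly K[3]}} :=
  ('X_(widen_ord (leqnSn 2) i))%:F / ('X_ord_max)%:F.

Lemma subst_t3E (K : fieldType) (A : {mpoly K[2]}) :
  subst_t3 A = mmap (constF K 3) (@affine_coord K) A.
Proof. by []. Qed.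

Lemma extend_affine_coord (K : fieldType) :
  extend (fun i => ('X_ord_max)%:F * affine_coord K i) ('X_ord_max)%:F
    =1 (fun i => ('X_i)%:F).
Proof.
move=> i; rewrite -[RHS](eq_extend (fun i => ('X_i)%:F)) /extend.
case: unliftP => [j|] _ //; rewrite /affine_coord mulrC divfK //.
by rewrite tofrac_eq0 X_neq0.
Qed.

Lemma tofrac_dehom (K : fieldType) d (F : {mpoly K[3]}) : F \is d.-homog ->
  F%:F = ('X_ord_max)%:F ^+ d * subst_t3 (dehom F).
Proof.
move=> Fd; rewrite subst_t3E -(homog_dehom _ _ _ Fd) tofrac_mpoly.
by apply: eq_mmap => // i; rewrite extend_affine_coord.
Qed.

Lemma dehom_eq0 (K : fieldType) d (F : {mpoly K[3]}) :
  F \is d.-homog -> dehom F = 0 -> F = 0.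
Proof.
move=> Fd F0; apply/eqP; rewrite -tofrac_eq0 (tofrac_dehom Fd) F0.
by rewrite subst_t3E rmorph0 mulr0.
Qed.

Lemma subst_t3_eq0 (K : fieldType) (A : {mpoly K[2]}) : subst_t3 A = 0 -> A = 0.
Proof.
move=> A0; have [N [Gh [_ GhE]]] := homogenize A.
have Gh0 : Gh = 0.
  apply/eqP; rewrite -tofrac_eq0 tofrac_mpoly.
  rewrite -(eq_mmap Gh (frefl (constF K 3)) (@extend_affine_coord K)).
  by rewrite GhE -subst_t3E A0 mulr0.
have := GhE _ (@mpolyC 2 K) (fun i => 'X_i) 1.
rewrite Gh0 rmorph0 expr1n mul1r -substE comp_mpoly_id.
by move->.
Qed.

Lemma dehom_subst (K : fieldType) (S : 'I_3 -> {mpoly K[3]}) (G : {mpoly K[3]}) :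
  (dehom G.[o S])%:F = mmap (constF K 2) (fun i => (dehom (S i))%:F) G.
Proof.
rewrite substE [dehom _](rmorph_mmap (comp_mpoly _)) /=.
rewrite (rmorph_mmap (@tofrac {mpoly K[2]})).
by apply: eq_mmap => [c|i] //=; rewrite comp_mpolyC.
Qed.

Section AffineMap.

Variables (K : fieldType) (s : nat) (S : 'I_3 -> {mpoly K[3]}).
Hypotheses (Ss : forall i, S i \is s.-homog) (S3 : S ord_max != 0).

(** The rational map S in the charts t_3 = 1 and s_3 = 1. *)
Definition affine_map (i : 'I_2) : {fraction {mpoly K[2]}} :=
  (dehom (S (widen_ord (leqnSn 2) i)))%:F / (dehom (S ord_max))%:F.

Lemma dehomS3_neq0 : (dehom (S ord_max))%:F != 0 :> {fraction {mpoly K[2]}}.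
Proof.
rewrite tofrac_eq0; apply: contraNneq S3 => d0.
by rewrite (dehom_eq0 (Ss _) d0).
Qed.

Lemma extend_affine_map :
  extend (fun i => (dehom (S ord_max))%:F * affine_map i) (dehom (S ord_max))%:F
    =1 (fun i => (dehom (S i))%:F).
Proof.
move=> i; rewrite -[RHS](eq_extend (fun i => (dehom (S i))%:F)) /extend.
case: unliftP => [j|] _ //; rewrite /affine_map mulrC divfK //.
exact: dehomS3_neq0.
Qed.

Lemma dehom_subst_affine d (F : {mpoly K[3]}) : F \is d.-homog ->
  (dehom F.[o S])%:F
    = (dehom (S ord_max))%:F ^+ d * mmap (constF K 2) affine_map (dehom F).
Proof.
move=> Fd; rewrite dehom_subst -(homog_dehom _ _ _ Fd).
by apply: eq_mmap => // i; rewrite extend_affine_map.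
Qed.

Lemma affine_map_independent (G : {mpoly K[2]}) : alg_independent S ->
  mmap (constF K 2) affine_map G = 0 -> G = 0.
Proof.
move=> indS G0; have [N [Gh [GhN GhE]]] := homogenize G.
have Gh0 : Gh = 0.
  apply: indS; apply: (dehom_eq0 (subst_homog Ss GhN)).
  apply/eqP; rewrite -tofrac_eq0 dehom_subst.
  rewrite -(eq_mmap Gh (frefl (constF K 2)) extend_affine_map).
  by rewrite GhE G0 mulr0.
have := GhE _ (@mpolyC 2 K) (fun i => 'X_i) 1.
by rewrite Gh0 rmorph0 expr1n mul1r -substE comp_mpoly_id => <-.
Qed.

End AffineMap.

Lemma mmap_linz (K : fieldType) (A : comNzRingType) (f : {rmorphism K -> A})
    (h : 'I_3 -> A) (A1 A0 : {mpoly K[2]}) :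
  mmap f h (linz A1 A0) =
    mmap f (fun i => h (widen_ord (leqnSn 2) i)) A1
      - mmap f (fun i => h (widen_ord (leqnSn 2) i)) A0 * h ord_max.
Proof.
rewrite /linz rmorphB rmorphM /= mmapXU /mwiden !(rmorph_mmap (mmap f h)).
by congr (_ - _ * _); apply: eq_mmap => [c|i] /=; rewrite ?mmapC ?mmapXU.
Qed.

Lemma muni_linz (K : fieldType) (A1 A0 : {mpoly K[2]}) :
  muni (linz A1 A0) = A1%:P - A0%:P * 'X.
Proof. by rewrite /linz muniB muniM !muni_widen muni_max. Qed.

Lemma size_muni_linz (K : fieldType) (A1 A0 : {mpoly K[2]}) :
  A0 != 0 -> size (muni (linz A1 A0)) = 2.
Proof.
move=> A00; rewrite muni_linz addrC -mulNr -polyCN size_MXaddC.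
rewrite polyC_eq0 oppr_eq0 (negPf A00) /=.
by rewrite size_polyC oppr_eq0 A00.
Qed.

Lemma linz_eq0 (K : fieldType) (A1 A0 : {mpoly K[2]}) :
  A0 != 0 -> linz A1 A0 != 0.
Proof.
move=> A00; apply/eqP => H0; have := size_muni_linz A1 A00.
by rewrite H0 muni0 size_poly0.
Qed.

Lemma two_factors x y : (0 < x)%N -> (0 < y)%N -> (x + y).-1 = 2%N ->
  x = 1%N \/ y = 1%N.
Proof. lia. Qed.

(** A fraction q_1/q_0 in lowest terms: among all equal fractions, one with a
    denominator of least degree.  In a factorization of A_1 - A_0 z one factor c
    does not involve z, so c divides A_1 and A_0 and must be constant. *)
Lemma linz_irreducible (K : fieldType) (q1 q0 : {mpoly K[2]}) : q0 != 0 ->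
  exists A1 A0, [/\ A0 != 0, A1 * q0 = A0 * q1 & irreducible_mpoly (linz A1 A0)].
Proof.
move=> q00.
have [|[A1 A0] /= [[A00 AE] Amin]] := @exists_minimizer _
  (fun A => msize A.2)
  (fun A : {mpoly K[2]} * {mpoly K[2]} => A.2 != 0 /\ A.1 * q0 = A.2 * q1).
  by exists (q1, q0); rewrite /= mulrC.
exists A1, A0; split=> //; split; first exact: linz_eq0.
  apply/negP => /unitrP[B [/(congr1 (@muni 2 K)) BH _]].
  have : muni (linz A1 A0) \is a GRing.unit.
    rewrite muniM muni1 in BH; apply/unitrP; exists (muni B).
    by split; [exact: BH | rewrite mulrC; exact: BH].
  by rewrite poly_unitE size_muni_linz.
have unitC (a b : {mpoly K[3]}) : linz A1 A0 = a * b -> size (muni a) = 1%N ->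
    a \is a GRing.unit.
  move=> abE sa; have /size_poly1P[c c0 aC] : size (muni a) == 1%N by rewrite sa.
  have aE : a = mwiden c by apply: muni_inj; rewrite aC muni_widen.
  have : muni a * muni b = A1%:P - A0%:P * 'X by rewrite -muniM -abE muni_linz.
  rewrite aC => E.
  have E0 : A1 = c * (muni b)`_0.
    have := congr1 (fun p : {poly _} => p`_0) E.
    by rewrite coefCM coefB coefC coefMX subr0 => ->.
  have E1 : A0 = c * - (muni b)`_1.
    have := congr1 (fun p : {poly _} => p`_1) E.
    by rewrite coefCM coefB coefC coefMX coefC /= sub0r mulrN => ->; rewrite opprK.
  have b10 : - (muni b)`_1 != 0 by apply: contraNneq A00 => b0; rewrite E1 b0 mulr0.
  have := Amin ((muni b)`_0, - (muni b)`_1) => /= H.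
  have /H : - (muni b)`_1 != 0 /\ (muni b)`_0 * q0 = - (muni b)`_1 * q1.
    by split=> //; apply: (mulfI c0); rewrite !mulrA -E0 -E1.
  rewrite {1}E1 msizeM // => sc.
  have : (msize c <= 1)%N.
    have : (0 < msize (- (muni b)`_1))%N by rewrite lt0n msize_poly_eq0.
    have : (0 < msize c)%N by rewrite lt0n msize_poly_eq0.
    by move: sc; clear; move: (msize _) (msize _) => x y; lia.
  move=> /msize1_polyC cC; rewrite aE cC mwidenC.
  have c00 : c@_0%MM != 0 by apply: contraNneq c0 => c00; rewrite cC c00 mpolyC0.
  apply/unitrP; exists ((c@_0%MM)^-1)%:MP.
  by rewrite -!mpolyCM mulVf // mulfV.
move=> a b abE.
have a0 : muni a != 0.
  rewrite -(muni0 2 K) (inj_eq (@muni_inj _ _)).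
  by apply: contraNneq (linz_eq0 A1 A00) => a0; rewrite abE a0 mul0r.
have b0 : muni b != 0.
  rewrite -(muni0 2 K) (inj_eq (@muni_inj _ _)).
  by apply: contraNneq (linz_eq0 A1 A00) => b0; rewrite abE b0 mulr0.
have := size_muni_linz A1 A00; rewrite abE muniM (size_mul a0 b0) => sab.
have : size (muni a) = 1%N \/ size (muni b) = 1%N ->
  a \is a GRing.unit \/ b \is a GRing.unit.
  move=> [sa|sb]; first by left; apply: (unitC a b).
  by right; apply: (unitC b a) => //; rewrite mulrC.
have sa : (0 < size (muni a))%N by rewrite size_poly_gt0.
have sb : (0 < size (muni b))%N by rewrite size_poly_gt0.
by move=> H; exact: (H (two_factors sa sb sab)).
Qed.

(** Pseudo-division by a polynomial of degree 1: the remainder is a constant r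
    with ev r = 0. *)
Lemma pseudo_multiple (R : idomainType) (M : fieldType)
    (ev : {rmorphism {poly R} -> M}) (g h : {poly R}) :
  size h = 2 -> (forall r, ev r%:P = 0 -> r = 0) -> ev g = 0 -> ev h = 0 ->
  exists c U, c != 0 /\ c%:P * g = U * h.
Proof.
move=> sh evC evg evh; have h0 : h != 0 by rewrite -size_poly_gt0 sh.
have := Pdiv.Idomain.divp_eq g h; set c := _ ^+ _ => E.
have c0 : c != 0 by rewrite expf_neq0 // lead_coef_eq0.
exists c, (g %/ h); split=> //; rewrite mul_polyC E.
have rC : g %% h = ((g %% h)`_0)%:P.
  by apply: size1_polyC; have := ltn_modp g h; rewrite h0 sh.
suff r0 : (g %% h)`_0 = 0 by rewrite rC r0 addr0.
apply: evC; rewrite -rC; have := congr1 ev E.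
by rewrite -mul_polyC rmorphD !rmorphM evg evh !mulr0 add0r => <-.
Qed.

Lemma constant_not_multiple (R : idomainType) (h V : {poly R}) c :
  size h = 2 -> c != 0 -> c%:P <> V * h.
Proof.
move=> sh c0 /(congr1 (fun p : {poly R} => size p)); rewrite size_polyC c0.
have h0 : h != 0 by rewrite -size_poly_gt0 sh.
have [->|V0] := eqVneq V 0; first by rewrite mul0r size_poly0.
rewrite size_mul // sh addn2 /= => -[] /eqP.
by rewrite eq_sym size_poly_eq0 (negPf V0).
Qed.

(** The ideal of the point h is generated by H = A_1 - A_0 z: some multiple c G
    of G with c free of z is a multiple of H, and the prime H does not divide
    c. *)
Lemma vanishing_ideal_linz (K : fieldType) (M : fieldType) (f : {rmorphism K -> M})
    (h : 'I_3 -> M) (A1 A0 : {mpoly K[2]}) (G : {mpoly K[3]}) :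
  generic f (fun i => h (widen_ord (leqnSn 2) i)) ->
  A0 != 0 -> irreducible_mpoly (linz A1 A0) ->
  mmap f h (linz A1 A0) = 0 -> mmap f h G = 0 ->
  divides (linz A1 A0) G.
Proof.
move=> gh A00 [H0 Hu Hirr] Hh Gh.
have [_ _ Hp] := factorial_irreducible_prime (@factorial_mpoly K 3) H0 Hu Hirr.
set H := linz A1 A0 in H0 Hu Hirr Hh Hp *.
have sH : size (muni H) = 2%N by apply: size_muni_linz.
have mH0 : muni H != 0 by rewrite -size_poly_gt0 sH.
clearbody H.
pose g (i : 'I_2) := h (widen_ord (leqnSn 2) i).
pose ev : {rmorphism {poly {mpoly K[2]}} -> M} :=
  horner_eval (h ord_max) \o map_poly (mmap f g).
have evG : ev (muni G) = 0 by rewrite horner_muni in Gh; exact: Gh.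
have evH : ev (muni H) = 0 by rewrite horner_muni in Hh; exact: Hh.
have evC r : ev r%:P = 0 -> r = 0.
  by rewrite /= map_polyC /horner_eval hornerC; apply: gh.
have [c [U [c0 E]]] := pseudo_multiple sH evC evG evH.
have /Hp[[V]|//] : divides H (mwiden c * G).
  exists (mmulti U); apply: muni_inj.
  rewrite muniM muni_widen muniM mmultiK; exact: E.
move/(congr1 (@muni 2 K)); rewrite muniM muni_widen => cE.
by case: (constant_not_multiple sH c0 cE).
Qed.

(** Every relation between the f_i holds at the points f(t), so these points are
    on the surface and H vanishes at all of them.  A homogenization with the
    common denominator D turns f(t) into polynomials in t. *)
Lemma parametrizes_vanishes (K : fieldType) n m
    (f : 'I_m -> {fraction {mpoly K[n]}}) (N : 'I_m -> {mpoly K[n]}) D H :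
  points_detect K -> D != 0 -> (forall i, f i = (N i)%:F / D%:F) ->
  parametrizes f (fun x => H.@[x] = 0) ->
  mmap (constF K n) f H = 0.
Proof.
move=> detK D0 fE fH.
have key (G : {mpoly K[m]}) : exists U k, U%:F = D%:F ^+ k * mmap (constF K n) f G /\
    forall t, D.@[t] != 0 ->
      U.@[t] = D.@[t] ^+ k * G.@[fun i => (N i).@[t] / D.@[t]].
  have [k [Gh [_ GhE]]] := homogenize G.
  exists Gh.[o extend N D], k; split=> [|t Dt].
    rewrite tofrac_subst -GhE; apply: eq_mmap => // i; rewrite /extend.
    by case: unliftP => [j|] _ //; rewrite fE mulrC divfK ?tofrac_eq0.
  rewrite meval_subst -[RHS](GhE _ idfun); apply: eq_mmap => // i; rewrite /extend.
  by case: unliftP => [j|] _ //; rewrite mulrC divfK.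
have [U [k [UE Ut]]] := key H.
have U0 : U = 0.
  apply/eqP; case: eqP => // /eqP U0.
  have [t] := detK _ _ (mulf_neq0 U0 D0).
  rewrite mevalM mulf_eq0 negb_or => /andP[/eqP Unt Dt]; case: Unt.
  rewrite Ut // (_ : H.@[_] = 0) ?mulr0 //.
  apply/fH => G G0; have [V [l [VE Vt]]] := key G.
  have V0 : V = 0.
    by apply/eqP; rewrite -tofrac_eq0 VE [mmap _ _ _]G0 mulr0.
  have := Vt t Dt; rewrite V0 meval0 => /esym/eqP.
  by rewrite mulf_eq0 expf_eq0 (negPf Dt) andbF => /eqP.
move: UE; rewrite U0 tofrac0 => /esym/eqP.
by rewrite mulf_eq0 expf_eq0 tofrac_eq0 (negPf D0) andbF => /eqP.
Qed.

(** * The surfaces parametrized by Phi and the homogenization *)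

Lemma subst_proj_eq (K : fieldType) n m k r (G : 'I_k -> {mpoly K[m]})
    (F F' : 'I_m -> {mpoly K[n]}) :
  (forall i, G i \is r.-homog) -> proj_eq F F' -> nonzero (rcomp G F) ->
  proj_eq (rcomp G F) (rcomp G F').
Proof.
move=> Gr FF [i GF].
apply: eq_proj_eq (proj_eq_forms (f := @mpolyC n K) Gr FF _) => [j|j|].
- by rewrite -substE.
- by rewrite -substE.
- by exists i; rewrite -substE.
Qed.

Lemma dehom_cross (K : fieldType) (F G F' G' : {mpoly K[3]}) :
  F * G = F' * G' ->
  (dehom F)%:F * (dehom G)%:F = (dehom F')%:F * (dehom G')%:F.
Proof.
move=> E; rewrite -!tofracM; congr tofrac.
by rewrite /dehom -!(rmorphM (comp_mpoly _)) E.
Qed.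

Lemma tofrac_common (R : idomainType) (x y z : R) : z != 0 ->
  x%:F / y%:F = (x * z)%:F / (y * z)%:F.
Proof.
by move=> z0; rewrite !tofracM invfM mulrACA divff ?mulr1 // tofrac_eq0.
Qed.

Lemma cross_quotient (M : fieldType) (a b c d w : M) :
  b != 0 -> w != 0 -> a * (w * d) = b * (w * c) -> a / b * d = c.
Proof.
move=> b0 w0 E; apply: (mulfI b0); apply: (mulfI w0).
by rewrite [RHS]mulrCA -E; field.
Qed.

Section Surfaces.

Variables (K : fieldType) (p q s : nat) (P Q : 'I_4 -> {mpoly K[3]})
  (S : 'I_3 -> {mpoly K[3]}).
Hypotheses (detK : points_detect K) (Pp : forall i, P i \is p.-homog) (Qq : forall i, Q i \is q.-homog)
  (Ss : forall i, S i \is s.-homog).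
Hypotheses (P4 : P ord_max != 0) (S3 : S ord_max != 0)
  (indS : alg_independent S) (QS : proj_eq P (rcomp Q S)).

Local Notation sigma := (affine_map S).
Local Notation at_sigma A := (mmap (constF K 2) sigma A).
Local Notation widen := (widen_ord (leqnSn _)).

Lemma Phi_widen j i : Phi P S j (widen i) = sigma i.
Proof.
have iE (k : 'I_3) : nat_of_ord i = nat_of_ord k -> widen i = k.
  by move=> ik; apply/val_inj.
case: i iE => [[|[|i]] lt] iE.
- by rewrite /affine_map (iE 0 erefl).
- by rewrite /affine_map (iE 1 erefl).
- by exfalso; move: (lt); rewrite !ltnS ltn0.
Qed.

Lemma Phi_max j : Phi P S j ord_max =
  (dehom (P (widen j)))%:F / (dehom (P ord_max))%:F.
Proof. by rewrite /Phi (tnth_nth 0). Qed.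

Lemma rcompQS4_neq0 : rcomp Q S ord_max != 0.
Proof.
have [_ [j Qj] E] := QS; apply: contraNneq P4 => Q4.
have := E ord_max j; rewrite Q4 mulr0 => /eqP.
by rewrite mulf_eq0 (negPf Qj) orbF.
Qed.

Lemma dehomP4_neq0 : (dehom (P ord_max))%:F != 0 :> {fraction {mpoly K[2]}}.
Proof.
rewrite tofrac_eq0; apply: contraNneq P4 => d0.
by rewrite (dehom_eq0 (Pp _) d0).
Qed.

Lemma at_sigmaQ4_neq0 : at_sigma (dehom (Q ord_max)) != 0.
Proof.
apply: contraNneq rcompQS4_neq0 => d0.
apply/eqP; apply: (dehom_eq0 (subst_homog Ss (Qq _))); apply/eqP.
by rewrite -tofrac_eq0 (dehom_subst_affine Ss S3 (Qq _)) d0 mulr0.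
Qed.

(** The relation P ~ Q o S read in the affine charts. *)
Lemma Phi_maxE j :
  Phi P S j ord_max * at_sigma (dehom (Q ord_max)) = at_sigma (dehom (Q (widen j))).
Proof.
have [_ _ /(_ (widen j) ord_max)/dehom_cross] := QS.
have dQS i : (dehom (rcomp Q S i))%:F
    = (dehom (S ord_max))%:F ^+ q * at_sigma (dehom (Q i)).
  exact (dehom_subst_affine Ss S3 (Qq i)).
rewrite (dQS ord_max) (dQS (widen j)) => E.
rewrite Phi_max; apply: cross_quotient E; first exact: dehomP4_neq0.
exact: expf_neq0 (dehomS3_neq0 Ss S3).
Qed.

Lemma linz_PhiE j A1 A0 :
  mmap (constF K 2) (Phi P S j) (linz A1 A0) * at_sigma (dehom (Q ord_max)) =
  at_sigma (A1 * dehom (Q ord_max) - A0 * dehom (Q (widen j))).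
Proof.
rewrite mmap_linz mulrBl -mulrA Phi_maxE rmorphB !rmorphM /=.
by congr (_ * _ - _ * _); apply: eq_mmap => // i; rewrite Phi_widen.
Qed.

(** Since sigma is a generic point of the plane, A_1 - A_0 z vanishes at Phi_j
    exactly when A_1/A_0 = Q_j(x,y,1)/Q_4(x,y,1). *)
Lemma linz_Phi_eq0 j A1 A0 : mmap (constF K 2) (Phi P S j) (linz A1 A0) = 0 <->
  A1 * dehom (Q ord_max) = A0 * dehom (Q (widen j)).
Proof.
split=> [H0|AE].
  apply/eqP; rewrite -subr_eq0; apply/eqP.
  apply: (affine_map_independent Ss S3 indS).
  by rewrite -(linz_PhiE j) H0 mul0r.
by apply: (mulIf at_sigmaQ4_neq0); rewrite linz_PhiE AE subrr rmorph0 mul0r.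
Qed.

Lemma Phi_surface_exists j : exists A1 A0, Phi_surface P S j A1 A0.
Proof.
have q40 : dehom (Q ord_max) != 0.
  by apply: contraNneq at_sigmaQ4_neq0 => ->; rewrite rmorph0.
have [A1 [A0 [A00 AE irr]]] := linz_irreducible (dehom (Q (widen j))) q40.
have HPhi := (linz_Phi_eq0 j A1 A0).2 AE.
exists A1, A0; split=> // x; split=> [Hx G GPhi|]; last by apply.
have [|U ->] := vanishing_ideal_linz (f := constF K 2) (h := Phi P S j) _ A00 irr HPhi GPhi.
  move=> F F0; apply: (affine_map_independent Ss S3 indS).
  by rewrite -F0; apply: eq_mmap => // i; rewrite Phi_widen.
by rewrite mevalM Hx mulr0.
Qed.

Lemma Phi_surface_eq j A1 A0 : Phi_surface P S j A1 A0 ->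
  A1 * dehom (Q ord_max) = A0 * dehom (Q (widen j)).
Proof.
move=> [A00 _ par]; apply/linz_Phi_eq0.
pose s3 := dehom (S ord_max); pose p4 := dehom (P ord_max).
have s30 : s3 != 0 by have := dehomS3_neq0 Ss S3; rewrite tofrac_eq0.
have p40 : p4 != 0 by have := dehomP4_neq0; rewrite tofrac_eq0.
apply: (parametrizes_vanishes (N := extend
    (fun i : 'I_2 => dehom (S (widen i)) * p4) (dehom (P (widen j)) * s3))
  (D := s3 * p4) detK) par.
  exact: mulf_neq0.
move=> i; rewrite -(eq_extend (Phi P S j)) /extend.
case: unliftP => [k|] _; first by rewrite Phi_widen; apply: tofrac_common.
by rewrite Phi_max [s3 * p4]mulrC; apply: tofrac_common.
Qed.

Lemma homogenization (A1 A0 : 'I_3 -> {mpoly K[2]}) :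
  (forall j, Phi_surface P S j (A1 j) (A0 j)) -> is_homogenization Q A1 A0.
Proof.
move=> par; have Q40 : (Q ord_max)%:F != 0 :> {fraction {mpoly K[3]}}.
  rewrite tofrac_eq0; apply: contraNneq rcompQS4_neq0 => Q40.
  by rewrite /rcomp Q40 comp_mpoly0.
apply: (proj_eqI (c := 1) (d := (Q ord_max)%:F)).
- by exists ord_max.
- exact: oner_neq0.
- exact: Q40.
move=> i; rewrite mul1r; case: unliftP => [j|] ->; last by rewrite mulr1.
have [A00 _ _] := par j; have AE := Phi_surface_eq (par j).
have sA0 : subst_t3 (A0 j) != 0 by apply: contraNneq A00 => /subst_t3_eq0 ->.
apply: (mulIf sA0); rewrite mulrA divfK // -widen_lift.
rewrite !(tofrac_dehom (Qq _)) -!mulrA; congr (_ * _).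
rewrite !subst_t3E -!rmorphM mulrC -AE; congr (mmap _ _ _).
exact: mulrC.
Qed.

End Surfaces.

(** * The reparametrization criterion *)

Lemma independent_nonzero_subst (K : fieldType) n m k
    (G : 'I_k -> {mpoly K[m]}) (S : 'I_m -> {mpoly K[n]}) :
  alg_independent S -> nonzero G -> nonzero (rcomp G S).
Proof.
move=> indS [i Gi]; exists i; apply/eqP => GS; move/eqP: Gi; apply.
exact: indS.
Qed.

Section Reparametrization.

Variables (K : fieldType) (L : closedFieldType)
  (iota : {rmorphism {fraction {mpoly K[3]}} -> L}).
Hypotheses (char0 : [pchar K] =i pred0) (detK : points_detect K).
Variables (X : ('I_4 -> K) -> Prop) (p q s : nat).
Variables (P Q : 'I_4 -> {mpoly K[3]}) (S : 'I_3 -> {mpoly K[3]}).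
Hypotheses (ratX : rational_surface X) (domP : dominant P X)
  (QX : maps_into Q X).
Hypotheses (Pp : forall i, P i \is p.-homog) (Qq : forall i, Q i \is q.-homog)
  (Ss : forall i, S i \is s.-homog).
Hypotheses (P0 : nonzero P) (Q0 : nonzero Q) (S0 : nonzero S)
  (QS : proj_eq P (rcomp Q S)).

Local Notation h := (genericL iota).
Local Notation cL := (constL iota).

Lemma pullback_independent : exists r (R : 'I_3 -> {mpoly K[4]}),
  [/\ forall i, R i \is r.-homog, (0 < p * r)%N & alg_independent (rcomp R P)].
Proof.
have [_ [B birB]] := ratX.
have [r [R [Rr RP]]] := dominant_independent detK birB.
by have [pr indRP] := RP _ _ _ Pp domP; exists r, R; split.
Qed.

(** R o P ~ (R o Q) o S is independent, so S is. *)
Lemma source_independent : (0 < s)%N /\ alg_independent S.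
Proof.
have [r [R [Rr pr indRP]]] := pullback_independent.
have RP0 : nonzero (rcomp R P).
  by exists ord0; apply: alg_independent_neq0.
have RPQS := subst_proj_eq Rr QS RP0.
have {}RPQS : proj_eq (rcomp R P) (rcomp (rcomp R Q) S).
  by apply: eq_proj_eq RPQS => i //; rewrite /rcomp substA.
have Vh := rcomp_homog Qq Rr.
have [sqr indV] := proj_eq_independent (rcomp_homog Ss Vh) RPQS indRP.
apply: (independent_source Ss Vh _ indV).
by move: sqr; rewrite muln_gt0 => /andP[].
Qed.

Lemma fiber_P_avoids a : generic_fiber iota P a -> avoids_curves cL a.
Proof.
have [r [R [Rr pr indRP]]] := pullback_independent.
move=> [_ Pah]; apply: (fiber_avoids_curves pr (rcomp_homog Pp Rr) indRP).
  exact: genericL_generic.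
have E b i : mmap cL b (rcomp R P i) = mmap cL (evalL iota P b) (R i).
  by rewrite mmap_subst.
apply: proj_eq_sym; apply: eq_proj_eq (proj_eq_forms Rr (proj_eq_sym Pah) _).
- by move=> i; rewrite E.
- by move=> i; rewrite E.
exists ord0; rewrite -E; apply/eqP => /genericL_generic/eqP.
by rewrite (negPf (alg_independent_neq0 _ indRP)).
Qed.

Lemma fiber_S_avoids a : generic_fiber iota S a -> avoids_curves cL a.
Proof.
have [s0 indS] := source_independent => -[_ Sah].
exact: (fiber_avoids_curves s0 Ss indS (@genericL_generic _ _ iota) Sah).
Qed.

(** If R is inverse to Q then S ~ R o P, and P ~ Q o S, so [fiber_transfer]
    applies in both directions. *)
Lemma solution_fibers : solves_reparametrization X P Q S ->
  forall a, generic_fiber iota P a <-> generic_fiber iota S a.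
Proof.
have [s0 indS] := source_independent.
move=> [[_ _ [R [[[r Rr] R0] RQ _ _]]] _ _] a.
have hh : avoids_curves cL h by apply/generic_avoids/genericL_generic.
have RQS : proj_eq (rcomp R (rcomp Q S)) S.
  have [RQ0 _ RQE] := RQ; split; [|exact: S0|].
    have [i Gi] := independent_nonzero_subst indS RQ0.
    by exists i; move: Gi; rewrite /rcomp substA.
  move=> i j; have := congr1 (comp_mpoly [tuple S k | k < 3]) (RQE i j).
  have SX k : ('X_k).[o S] = S k by rewrite substE mmapXU.
  by rewrite !(rmorphM (comp_mpoly _)) /= !SX /rcomp !substA.
have SRP : proj_eq S (rcomp R P).
  apply: proj_eq_trans (proj_eq_sym RQS) _.
  by apply: (subst_proj_eq Rr (proj_eq_sym QS)); case: RQS.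
split=> fa; have aa : avoids_curves cL a.
- exact: fiber_P_avoids.
- by case: fa => a0 Pah; split=> //; apply: (fiber_transfer Ss Pp Rr SRP aa hh).
- exact: fiber_S_avoids.
- by case: fa => a0 Sah; split=> //; apply: (fiber_transfer Pp Ss Qq QS aa hh).
Qed.

Lemma dominant_of_factor : dominant Q X.
Proof.
split=> // G [e Ge] GQ; have [_ PX] := domP.
have {}GQ := vanishes_on_image detK Q0 GQ.
have GP : G.[o P] = 0.
  rewrite substE; apply: (form_eq0 Ge (proj_eq_sym QS)).
  by rewrite -substE -substA GQ comp_mpoly0.
apply: PX => [|t _ _]; first by exists e.
have <- : (G.[o P]).@[t] = G.@[evalv P t] by apply: meval_subst.
by rewrite GP meval0.
Qed.

(** From R o P ~ S and P ~ Q o S one gets (R o Q) o S ~ S and (Q o R) o P ~ P.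
    Independence of S removes S from the former, dominance of P removes P from
    the latter. *)
Lemma inverse_birational e (R : 'I_3 -> {mpoly K[4]}) :
  (forall i, R i \is e.-homog) -> proj_eq (rcomp R P) S -> birational Q X.
Proof.
move=> Re RPS; have [s0 indS] := source_independent.
have [RP0 _ RPE] := RPS.
have RQS : proj_eq (rcomp (rcomp R Q) S) S.
  apply: proj_eq_trans RPS; apply: proj_eq_sym.
  by apply: eq_proj_eq (subst_proj_eq Re QS RP0) => i //; rewrite /rcomp substA.
have QRP : proj_eq (rcomp Q (rcomp R P)) P.
  apply: proj_eq_sym; apply: proj_eq_trans QS _.
  by apply: (subst_proj_eq Qq (proj_eq_sym RPS)); case: QS.
have R0 : nonzero R.
  case: RP0 => i RPi; exists i; apply: contraNneq RPi => Ri.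
  by rewrite /rcomp Ri comp_mpoly0.
split; [by split=> //; exists q | exact: dominant_of_factor |].
have evP t i : evalv R (evalv P t) i = (rcomp R P i).@[t].
  by apply/esym; apply: meval_subst.
have evQ t i : evalv Q (evalv R (evalv P t)) i = (rcomp Q (rcomp R P) i).@[t].
  transitivity ((Q i).@[fun j => (rcomp R P j).@[t]]).
    by apply: meval_eq => j; apply: evP.
  by apply/esym; apply: meval_subst.
exists R; split.
- by split=> //; exists e.
- have [[i RQi] _ RQE] := RQS; split.
  + exists i; apply: contraNneq RQi => Ri.
    by rewrite [rcomp _ _ i]/rcomp Ri comp_mpoly0.
  + by exists ord0; apply: X_neq0.
  move=> k l; apply/eqP; rewrite -subr_eq0; apply/eqP; apply: indS.
  have SX j : ('X_j).[o S] = S j by rewrite substE mmapXU.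
  rewrite (rmorphB (comp_mpoly _)) !(rmorphM (comp_mpoly _)) /= !SX.
  by apply/eqP; rewrite subr_eq0; apply/eqP; apply: RQE.
(* a point P(t) with t off the curves where one of the maps is undefined *)
- have [[i QRPi] _ _] := QRP; have [j RPj] := RP0; have [k Pk] := P0.
  have [t] := detK (mulf_neq0 (mulf_neq0 QRPi RPj)
                                    (mulf_neq0 Pk (X_neq0 K (ord0 : 'I_3)))).
  rewrite !mevalM mevalXU !mulf_eq0 !negb_or.
  move=> /andP[/andP[Qt Rt] /andP[Pt t0]].
  exists (evalv P t); split.
  + by case: domP => + _; apply; [exists ord0 | exists k].
  + by exists j; rewrite evP.
  + by exists i; rewrite evQ.
move=> x Xx _ QRx; split=> //.
  by case: ratX => [[F [_ _ XF]] _]; case/XF: Xx.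
move=> i j; pose G := (Q i).[o R] * 'X_j - (Q j).[o R] * 'X_i.
suff : G.@[x] = 0.
  rewrite mevalB !mevalM !mevalXU !meval_subst => /eqP; rewrite subr_eq0 => /eqP E.
  exact: E.
case: domP => _; apply=> // [|t _ _].
  exists (e * q + 1)%N.
  have X1 k : ('X_k : {mpoly K[4]}) \is 1.-homog by rewrite dhomogX /= mdeg1.
  by apply: rpredB; apply: dhomogM => //; apply: subst_homog.
have <- : (G.[o P]).@[t] = G.@[evalv P t] by apply: meval_subst.
have PX k : ('X_k).[o P] = P k by rewrite substE mmapXU.
rewrite /G (rmorphB (comp_mpoly _)) !(rmorphM (comp_mpoly _)) /= !PX !substA.
have [_ _ E] := QRP.
by rewrite [X in X - _](E i j) subrr meval0.
Qed.

Lemma fibers_solution :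
  (forall a, generic_fiber iota P a <-> generic_fiber iota S a) ->
  solves_reparametrization X P Q S.
Proof.
move=> PS; have [r [R0 [Rr pr indRP]]] := pullback_independent.
have [e [R [Re RPS]]] := fiber_inclusion_descends char0 Pp Rr pr indRP P0 Ss S0
  (fun a => (PS a).1).
split; [exact: inverse_birational Re RPS | by split=> //; exists s | exact: QS].
Qed.

Lemma reparametrization_criterion : P ord_max != 0 -> S ord_max != 0 ->
  (solves_reparametrization X P Q S <->
   (forall a, generic_fiber iota P a <-> generic_fiber iota S a)) /\
  ((forall j, exists A1 A0, Phi_surface P S j A1 A0) /\
   (forall A1 A0 : 'I_3 -> {mpoly K[2]},
      (forall j, Phi_surface P S j (A1 j) (A0 j)) ->
      is_homogenization Q A1 A0)).
Proof.
move=> P4 S3; have [_ indS] := source_independent.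
split; first by split; [exact: solution_fibers | exact: fibers_solution].
split=> [j|A1 A0 par]; first exact: (Phi_surface_exists Pp Qq Ss P4 S3 indS QS j).
exact: (homogenization detK Pp Qq Ss P4 S3 indS QS par).
Qed.

End Reparametrization.

Theorem theorem1 (K : closedFieldType) (charK0 : [pchar K] =i pred0)
  (L : closedFieldType) (iota : {rmorphism {fraction {mpoly K[3]}} -> L})
  (closureL : is_algebraic_closure iota)
  (X : ('I_4 -> K) -> Prop) (ratX : rational_surface X)
  (P : 'I_4 -> {mpoly K[3]})
  (ratP : rational_map P) (gcdP : coprime_family P) (p4_neq0 : P ord_max != 0)
  (domP : dominant P X) (nbirP : ~ birational P X)
  (Q : 'I_4 -> {mpoly K[3]}) (ratQ : rational_map Q) (QX : maps_into Q X)
  (S : 'I_3 -> {mpoly K[3]}) (ratS : rational_map S) (s3_neq0 : S ord_max != 0)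
  (QS : proj_eq P (rcomp Q S)) :
  (solves_reparametrization X P Q S <->
   (forall a : 'I_3 -> L, generic_fiber iota P a <-> generic_fiber iota S a)) /\
  (solves_reparametrization X P Q S \/
   (forall a : 'I_3 -> L, generic_fiber iota P a <-> generic_fiber iota S a) ->
   (forall j : 'I_3, exists A1 A0 : {mpoly K[2]}, Phi_surface P S j A1 A0) /\
   (forall A1 A0 : 'I_3 -> {mpoly K[2]},
      (forall j, Phi_surface P S j (A1 j) (A0 j)) ->
      is_homogenization Q A1 A0)).
Proof.
have [[p Pp] P0] := ratP; have [[q Qq] Q0] := ratQ; have [[s Ss] S0] := ratS.
have [crit conseq] := reparametrization_criterion iota charK0
  (@closed_points_detect K) ratX domP QX Pp Qq Ss P0 Q0 S0 QS p4_neq0 s3_neq0.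
by split=> [|_]; [exact: crit | exact: conseq].
Qed.
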